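(* For every integer $d\geq 2$ and every integer $n\geq (30d)^{2d^2}$, $$1<\frac{\log p_d(n)}{n^{1-\frac{1}{d}}}<7200.$$
   Context: Let $\mathbb{Z}_+=\{0,1,2,\dots\}$. A set $S\subset\mathbb{Z}_+^d$ is a lower set (downward closed set) if whenever $\mathbf{x}=(x_1,\dots,x_d)\in S$ and $\mathbf{x}'\in\mathbb{Z}_+^d$ satisfies $x'_i\leq x_i$ for all $1\leq i\leq d$, then $\mathbf{x}'\in S$. For positive integers $d,n$, $p_d(n)$ denotes the number of lower sets in $\mathbb{Z}_+^d$ with exactly $n$ points (equivalently, the number of $(d-1)$-dimensional integer partitions of $n$). $\log$ is the natural logarithm. *)

(* Defs.v *)
From Stdlib Require Import Reals.
From mathcomp Require Import all_boot.
Set Implicit Arguments. Unset Strict Implicit. Unset Printing Implicit Defensive.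

Definition box (d n : nat) := {ffun 'I_d -> 'I_n}.

Definition lower_set (d n : nat) (S : {set box d n}) : bool :=
  [forall x in S, forall y : box d n,
     [forall i, (nat_of_ord (y i) <= nat_of_ord (x i))%N] ==> (y \in S)].

(* p_d(n): number of lower sets in Z_+^d with exactly n points.  Every such
   lower set lies in the box [0,n-1]^d (a point with coordinate x_i = m has the
   m+1 points (0,..,k,..,0), k<=m, below it), and a subset of the box is a
   lower set of Z_+^d iff it is downward closed within the box. *)
Definition p (d n : nat) : nat :=
  #|[set S : {set box d n} | lower_set S && (#|S| == n)]|.

(* Main.v *)
(**
Lower bound. Let T be the simplex of all points of coordinate sum less than m.
The union of T and any set of points of sum m that misses the first axis is a
lower set, and it can be completed to exactly n points, without loss of
information, by lengthening its arm along the first axis. If m is maximal for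
this to fit, one gets 2 ^ (L - 1) sets with L about d n^(1-1/d) / (d!)^(1/d).
For d = 2 this is slightly too small and one uses all lattice paths in a square
of side about sqrt n instead.

Upper bound. Rank all pairs (k, m), meaning "level m of axis k", in a uniformly
random order. Every point x picks the two axes i, j for which the least rank of
(i, m), m <= x_i, is smallest. The points that pick {i, j} and agree outside i
and j form a quadrant, so a lower set S of size n is a disjoint union of Young
diagrams, one for each corner z of such a quadrant that lies in S. If z is a
corner, then (i, z_i) and (j, z_j) are the two least ranked among the
|z| = sum (z_k + 1) pairs (k, m), m <= z_k, which has probability
2 / (|z| (|z| - 1)). The expected number of corners is thus at most the sum of
d (d - 1) / (|z| (|z| - 1)) over S, which is O(n^(1-2/d)) with a constant that
does not depend on d. By averaging, some ranking has at least half as many lower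
sets of size n with N = O(n^(1-2/d)) corners as there are lower sets of size n.
The generating function of partitions at q = M / (M + 1), M about n^(1/d), bounds
the number of the former by (n^d d^2 + 1)^N e^(n / M) e^(4 M N) = e^O(n^(1-1/d)).
*)
Require Import Defs.
From Stdlib Require Import Reals.
From Stdlib Require Lra.
From mathcomp Require Import all_boot all_order all_algebra all_fingroup.
From mathcomp Require Import zify ring lra Rstruct.
Set Implicit Arguments. Unset Strict Implicit. Unset Printing Implicit Defensive.

(** * Leading axes and corners *)

Lemma lower_setP d n (S : {set box d n}) :
  reflect (forall x y : box d n, x \in S -> (forall i, y i <= x i) -> y \in S)
          (lower_set S).
Proof.
apply: (iffP 'forall_implyP) => [H x y xS le_yx|H x xS].
  by move/forallP: (H x xS) => /(_ y) /implyP; apply; apply/forallP.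
by apply/forallP => y; apply/implyP => /forallP; apply: H.
Qed.

Section Leads.

Variables (d n : nat) (w : 'I_d * 'I_n -> nat).
Hypothesis w_inj : injective w.
Implicit Types (i j k : 'I_d) (a b m : 'I_n) (x y z : box d n).

(** The [a] after [<] is the default index of [arg min]; the minimum runs over all m <= a, including
    a. *)
Definition row_min k a := w (k, [arg min_(m < a | m <= a) w (k, m)]).

Lemma row_minP k a : exists2 m : 'I_n, m <= a & row_min k a = w (k, m).
Proof. by rewrite /row_min; case: arg_minnP => // m le_ma _; exists m. Qed.

Lemma row_min_le k a m : m <= a -> row_min k a <= w (k, m).
Proof. by rewrite /row_min; case: arg_minnP => // m' _; apply. Qed.

Lemma row_min_anti k a b : a <= b -> row_min k b <= row_min k a.
Proof.
by move=> le_ab; have [m le_ma ->] := row_minP k a; apply/row_min_le/(leq_trans le_ma).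
Qed.

Lemma row_min_inj k k' a b : row_min k a = row_min k' b -> k = k'.
Proof.
by have [m _ ->] := row_minP k a; have [m' _ ->] := row_minP k' b; move/w_inj => [].
Qed.

(* The values of [x] at [i] and [j] are ignored: this makes the points led by [i] and [j] form quadrants. *)
Definition ahead i j x a :=
  [forall k, (k != i) && (k != j) ==> (row_min i a < row_min k (x k))].

Definition leads i j x := ahead i j x (x i) && ahead j i x (x j).

(** [ahead i j] and [ahead j i] restrict the coordinates i and j separately, each to an up-set; a
    corner is the least point of the resulting quadrant. *)
Definition corner i j z :=
  [&& leads i j z, [forall a, ahead i j z a ==> (z i <= a)]
    & [forall b, ahead j i z b ==> (z j <= b)]].

Lemma aheadP i j x a :
  reflect (forall k, k != i -> k != j -> row_min i a < row_min k (x k)) (ahead i j x a).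
Proof.
apply: (iffP forallP) => H k; last by apply/implyP => /andP[]; apply: H.
by move=> ki kj; apply: (implyP (H k)); rewrite ki.
Qed.

Lemma ahead_eq i j x y a :
  (forall k, k != i -> k != j -> x k = y k) -> ahead i j x a = ahead i j y a.
Proof.
move=> exy; apply/aheadP/aheadP => H k ki kj; have := H k ki kj; by rewrite exy.
Qed.

Lemma ahead_mono i j x a b : a <= b -> ahead i j x a -> ahead i j x b.
Proof.
by move=> le_ab /aheadP H; apply/aheadP => k ki kj; apply: leq_ltn_trans (H k ki kj); apply: row_min_anti.
Qed.

Lemma leadsP i j x :
  reflect (forall k, k != i -> k != j ->
             row_min i (x i) < row_min k (x k) /\ row_min j (x j) < row_min k (x k))
          (leads i j x).
Proof.
apply: (iffP andP) => [[/aheadP Hi /aheadP Hj] k ki kj|H].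
  by split; [apply: Hi | apply: Hj].
by split; apply/aheadP => k ki kj; [case: (H k ki kj) | case: (H k kj ki)].
Qed.

Lemma leads_sym i j x : leads i j x = leads j i x.
Proof. by rewrite /leads andbC. Qed.

Lemma corner_sym i j z : corner i j z = corner j i z.
Proof. by rewrite /corner leads_sym; congr andb; rewrite andbC. Qed.

(** If i were neither i' nor j', both of these would have smaller row minima than i. Only j can, so
    i' = j'. *)
Lemma leads_uniq i j i' j' x : i' != j' ->
  leads i j x -> leads i' j' x -> (i == i') || (i == j').
Proof.
move=> ij' /leadsP H /leadsP H'; apply/contraT; rewrite negb_or => /andP[ii' nij'].
have [lt_i' lt_j'] := H' i ii' nij'.
have e k : row_min k (x k) < row_min i (x i) -> k = j.
  move=> lt_k; apply/eqP/contraT => kj.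
  have ki : k != i by apply: contraTneq lt_k => ->; rewrite ltnn.
  by have [] := H k ki kj; rewrite ltnNge ltnW.
by rewrite (e _ lt_i') (e _ lt_j') eqxx in ij'.
Qed.

Lemma leads_uniq2 i j i' j' x : i < j -> i' < j' ->
  leads i j x -> leads i' j' x -> i = i' /\ j = j'.
Proof.
move=> lt_ij lt_ij' L L'.
have nij : j != i by rewrite neq_ltn lt_ij orbT.
have nij' : j' != i' by rewrite neq_ltn lt_ij' orbT.
have nij'' : i' != j' by rewrite eq_sym.
have h1 := leads_uniq nij'' L L'.
have h2 : (j == i') || (j == j') by rewrite leads_sym in L; apply: leads_uniq L L'.
case/orP: h1 h2 => /eqP e1 /orP[] /eqP e2; subst => //.
- by rewrite eqxx in nij.
- by move: (ltn_trans lt_ij lt_ij'); rewrite ltnn.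
- by rewrite eqxx in nij.
Qed.

Lemma leads_exist x : 2 <= d -> exists i j, i < j /\ leads i j x.
Proof.
move=> d2; pose g k := row_min k (x k).
have g_lt i k : k != i -> g i <= g k -> g i < g k.
  by move=> ki; rewrite leq_eqVlt => /orP[/eqP/row_min_inj e|//]; rewrite e eqxx in ki.
pose k0 : 'I_d := Ordinal (ltnW d2); pose k1 : 'I_d := Ordinal d2.
have [i _ Hi] := @arg_minnP _ k0 predT g isT.
have [j nij Hj] : exists2 j, j != i & forall k, k != i -> g j <= g k.
  (* One of [k0] and [k1] differs from i, so the second minimum is over a nonempty set. *)
  have [/eqP e|ne] := boolP (k0 == i).
    by have [|j] := @arg_minnP _ k1 (fun k => k != i) g; [rewrite -e | exists j].
  by have [|j] := @arg_minnP _ k0 (fun k => k != i) g; [rewrite ne | exists j].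
have L : leads i j x.
  by apply/leadsP => k ki kj; split; apply: g_lt => //; [apply: Hi | apply: Hj].
move: nij; rewrite neq_ltn => /orP[] lt; last by exists i, j.
by exists j, i; rewrite leads_sym.
Qed.

Definition upd z i j a b : box d n :=
  [ffun k => if k == i then a else if k == j then b else z k].

Lemma upd_i z i j a b : upd z i j a b i = a.
Proof. by rewrite ffunE eqxx. Qed.

Lemma upd_j z i j a b : j != i -> upd z i j a b j = b.
Proof. by move=> ji; rewrite ffunE eqxx (negbTE ji). Qed.

Lemma upd_k z i j a b k : k != i -> k != j -> upd z i j a b k = z k.
Proof. by move=> ki kj; rewrite ffunE (negbTE ki) (negbTE kj). Qed.

Lemma upd_id z x i j :
  (forall k, k != i -> k != j -> x k = z k) -> upd z i j (x i) (x j) = x.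
Proof.
move=> e; apply/ffunP => k; rewrite ffunE.
have [->//|ki] := eqVneq k i; have [->//|kj] := eqVneq k j.
by rewrite e.
Qed.

Lemma corner_exist i j x : i != j -> leads i j x ->
  exists z, [/\ corner i j z, z i <= x i, z j <= x j
              & forall k, k != i -> k != j -> x k = z k].
Proof.
move=> nij /andP[ai aj].
have [a Ha min_a] := @arg_minnP _ (x i) (ahead i j x) (fun a => a : nat) ai.
have [b Hb min_b] := @arg_minnP _ (x j) (ahead j i x) (fun b => b : nat) aj.
have nji : j != i by rewrite eq_sym.
have e k : k != i -> k != j -> x k = upd x i j a b k by move=> ki kj; rewrite upd_k.
have e' k : k != j -> k != i -> x k = upd x i j a b k by move=> kj ki; rewrite upd_k.
exists (upd x i j a b); split; rewrite ?upd_i ?(upd_j _ _ _ nji) ?min_a ?min_b //.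
rewrite /corner /leads upd_i (upd_j _ _ _ nji) -(ahead_eq _ e) -(ahead_eq _ e') Ha Hb /=.
apply/andP; split; apply/forallP => c; apply/implyP.
  by rewrite -(ahead_eq _ e); apply: min_a.
by rewrite -(ahead_eq _ e'); apply: min_b.
Qed.

Lemma corner_leads i j z x : corner i j z -> z i <= x i -> z j <= x j ->
  (forall k, k != i -> k != j -> x k = z k) -> leads i j x.
Proof.
move=> /and3P[/andP[Hi Hj] _ _] lei lej e; apply/andP; split.
  by rewrite (ahead_eq _ e); apply: ahead_mono Hi.
by rewrite (@ahead_eq j i x z) => [|k kj ki]; [apply: ahead_mono Hj | apply: e].
Qed.

Lemma corner_uniq i j z z' : corner i j z -> corner i j z' ->
  (forall k, k != i -> k != j -> z k = z' k) -> z = z'.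
Proof.
move=> /and3P[/andP[Hi Hj] /forallP mi /forallP mj].
move=> /and3P[/andP[Hi' Hj'] /forallP mi' /forallP mj'] e.
have e' k : k != j -> k != i -> z k = z' k by move=> *; apply: e.
apply/ffunP => k; apply/val_inj/eqP; rewrite /= eqn_leq.
have [->|ki] := eqVneq k i.
  by apply/andP; split; [apply: (implyP (mi _)); rewrite (ahead_eq _ e)
                        |apply: (implyP (mi' _)); rewrite -(ahead_eq _ e)].
have [->|kj] := eqVneq k j.
  by apply/andP; split; [apply: (implyP (mj _)); rewrite (ahead_eq _ e')
                        |apply: (implyP (mj' _)); rewrite -(ahead_eq _ e')].
by rewrite e // leqnn.
Qed.

Definition below x : {set 'I_d * 'I_n} := [set t : 'I_d * 'I_n | t.2 <= x t.1].

(** An index m' < z_i minimising row i would be ahead as well, against the minimality of z_i. So w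
    (i, z_i) is a row minimum, smaller than those of the third axes. Used also with i and j swapped,
    this makes (i, z_i) and (j, z_j) the two least ranked elements of [below z]. *)
Lemma corner_tip i j z t : i != j -> corner i j z -> t \in below z ->
  t != (i, z i) -> t != (j, z j) -> w (i, z i) < w t.
Proof.
move=> nij /and3P[/andP[/aheadP Hi Hj] /forallP mi /forallP mj].
case: t => k m; rewrite inE /= => le_m ti tj.
have [m' le_m' e] := row_minP i (z i).
have em' : m' = z i.
  apply/val_inj/eqP; rewrite /= eqn_leq le_m' /=; apply: (implyP (mi m')).
  apply/aheadP => k' ki kj; apply: leq_ltn_trans (Hi k' ki kj).
  by rewrite e; apply: row_min_le.
rewrite em' in e.
have [eki|ki] := eqVneq k i.
  subst k; rewrite ltn_neqAle -e row_min_le // andbT e.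
  by apply: contraNneq ti => /w_inj ->.
have [ekj|kj] := eqVneq k j; last first.
  by rewrite -e; apply: leq_trans (Hi k ki kj) _; apply: row_min_le.
subst k; have nle : ~~ (z j <= m).
  apply: contraNN tj => le_zm; rewrite xpair_eqE eqxx /=.
  by apply/eqP/val_inj/eqP; rewrite /= eqn_leq le_m.
(* As m < z_j is not ahead, some third axis k has row minimum at most w (j, m), and row i beats row
   k. *)
have : ~~ ahead j i z m by apply: contraNN nle; apply/implyP.
rewrite negb_forall => /existsP[k]; rewrite negb_imply -leqNgt => /andP[/andP[nkj nki] le_k].
rewrite -e; apply: leq_trans (Hi k nki nkj) _; apply: leq_trans le_k _.
exact: row_min_le.
Qed.

End Leads.

(** * Coding a lower set by Young diagrams *)

Lemma card_ord_interval n c c' : c' <= n -> #|[set a : 'I_n | c <= a < c']| = c' - c.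
Proof.
move=> le_n; rewrite cardsE -sum1_card.
rewrite (eq_bigl (fun a : 'I_n => (c <= a) && (a < c'))) //.
rewrite -(big_mkord (fun a => (c <= a) && (a < c')) (fun=> 1)).
have [le_cc|/ltnW le_cc] := leqP c c'; last first.
  have /eqP-> : c' - c == 0 by rewrite subn_eq0.
  rewrite big1_seq // => a /andP[/andP[le1 lt2] _].
  by have := leq_ltn_trans (leq_trans le_cc le1) lt2; rewrite ltnn.
rewrite -(big_nat_widen 0 c' n (fun a => c <= a)) //.
have := big_nat_widenl c 0 c' xpredT (fun=> 1) (leq0n c).
by rewrite /= => <-; rewrite sum_nat_const_nat muln1.
Qed.

(** If P a holds, the whole interval from c to a is counted; if not, only indices below a can be.
    This recovers a diagram from its column heights. *)
Lemma mem_initial_segment n (c : 'I_n) (P : pred 'I_n) (a : 'I_n) :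
  (forall a b : 'I_n, c <= a -> a <= b -> P b -> P a) -> c <= a ->
  P a = (a - c < #|[set a' : 'I_n | c <= a' & P a']|).
Proof.
move=> down le_ca; apply/idP/idP => [Pa|].
  have e : #|[set a' : 'I_n | c <= a' < a.+1]| = a.+1 - c by apply: card_ord_interval.
  rewrite -subSn // -e; apply/subset_leq_card/subsetP => a'.
  rewrite !inE ltnS => /andP[le_c le_a]; rewrite le_c; exact: down le_c le_a Pa.
apply: contraTT => nPa; rewrite -leqNgt.
have e : #|[set a' : 'I_n | c <= a' < a]| = a - c by apply: card_ord_interval; apply: ltnW.
rewrite -e; apply/subset_leq_card/subsetP => a'.
rewrite !inE => /andP[-> Pa'] /=; rewrite ltnNge; apply: contraNN nPa => le_aa'.
exact: down le_ca le_aa' Pa'.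
Qed.

Section Code.

Variables (d n : nat).
Notation pt := (box d n).
Notation corner_t := (pt * ('I_d * 'I_d))%type.
Implicit Types (S : {set pt}) (e : corner_t).

(** Here [e] = (z, (i, j)) stands for the quadrant with apex z in the directions i and j; a and b
    are absolute coordinates, not relative to z. *)
Definition in_slice S e (a b : 'I_n) :=
  [&& e.1 e.2.1 <= a, e.1 e.2.2 <= b & upd e.1 e.2.1 e.2.2 a b \in S].

Definition height S e (b : 'I_n) := #|[set a | in_slice S e a b]|.

(* The two-dimensional slice of [S] at [e] is a Young diagram, encoded by the number of its columns of each height. *)
Definition code S e (k : 'I_n) := #|[set b | height S e b == k.+1]|.

Lemma height_le S e b : height S e b <= n.
Proof. by rewrite -[X in _ <= X]card_ord max_card. Qed.

Lemma code_le S e k : code S e k <= n.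
Proof. by rewrite -[X in _ <= X]card_ord max_card. Qed.

Lemma sum_code_tail S e c :
  \sum_(k < n | c <= k) code S e k = #|[set b | c < height S e b]|.
Proof.
transitivity (\sum_(b : 'I_n) \sum_(k < n | c <= k) (height S e b == k.+1 : nat)).
  rewrite exchange_big /=; apply: eq_bigr => k _.
  by rewrite /code cardsE -sum1_card big_mkcond.
rewrite cardsE -sum1_card [RHS]big_mkcond; apply: eq_bigr => b _.
rewrite (_ : (b \in _) = (c < height S e b)) //; case: ifP => [lt_h|/negbT nlt_h].
  have lt_n : (height S e b).-1 < n.
    by have := height_le S e b; case: (height S e b) lt_h => [|h] //= _ le_h.
  rewrite (bigD1 (Ordinal lt_n)) /=; last by case: (height S e b) lt_h.
  rewrite prednK; last by apply: leq_ltn_trans lt_h.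
  rewrite eqxx big1 // => k /andP[_ nk]; case: eqP => // eh.
  by case/eqP: nk; apply/val_inj; rewrite /= eh.
rewrite big1 // => k le_k; case: eqP => // eh.
by rewrite eh ltnS le_k in nlt_h.
Qed.

Lemma sum_code_size S e :
  \sum_(k < n) k.+1 * code S e k = #|[set ab : 'I_n * 'I_n | in_slice S e ab.1 ab.2]|.
Proof.
have -> : #|[set ab : 'I_n * 'I_n | in_slice S e ab.1 ab.2]| = \sum_(b : 'I_n) height S e b.
  under eq_bigr => b _ do rewrite /height cardsE -sum1_card big_mkcond.
  rewrite exchange_big pair_big cardsE -sum1_card big_mkcond.
  by apply: eq_bigr => -[a b] _.
(* Columns are grouped by height; height 0 contributes nothing, and [lift ord0 k] is height k +
   1. *)
rewrite [RHS](partition_big (fun b : 'I_n => inord (height S e b) : 'I_n.+1) xpredT) //=.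
rewrite [RHS]big_ord_recl /= [X in _ = X + _]big1 ?add0n => [|b]; last first.
  by rewrite -val_eqE /= inordK ?ltnS ?height_le // => /eqP.
apply: eq_bigr => k _; rewrite mulnC /code -sum_nat_const.
have h_lift b : (inord (height S e b) == lift ord0 k :> 'I_n.+1) = (height S e b == k.+1).
  by rewrite -val_eqE /= inordK ?ltnS ?height_le.
by apply: eq_big => [b|b]; rewrite inE ?h_lift // => /eqP.
Qed.

Variable w : 'I_d * 'I_n -> nat.
Hypothesis w_inj : injective w.

Definition corners S : {set corner_t} :=
  [set e : corner_t | [&& e.2.1 < e.2.2, corner w e.2.1 e.2.2 e.1 & e.1 \in S]].

(** The diagrams at different corners are disjoint parts of S: a point determines its leading pair
    (i, j), then its coordinates a and b, then the corner of its quadrant. *)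
Lemma sum_code_corners S :
  \sum_(e in corners S) \sum_(k < n) k.+1 * code S e k <= #|S|.
Proof.
under eq_bigr => e _ do rewrite sum_code_size -sum1_card.
rewrite (eq_bigr (fun e => \sum_(ab : 'I_n * 'I_n | in_slice S e ab.1 ab.2) 1)); last first.
  by move=> e _; apply: eq_bigl => ab; rewrite inE.
rewrite pair_big_dep sum1_card.
pose V := [pred u : corner_t * ('I_n * 'I_n) | (u.1 \in corners S) && in_slice S u.1 u.2.1 u.2.2].
pose f (u : corner_t * ('I_n * 'I_n)) := upd u.1.1 u.1.2.1 u.1.2.2 u.2.1 u.2.2.
have f_inj : {in V &, injective f}.
  move=> [[z [i j]] [a b]] [[z' [i' j']] [a' b']].
  rewrite !inE /f /= => /andP[/and3P[lt_ij cz _] /and3P[/= le_a le_b _]].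
  move=> /andP[/and3P[lt_ij' cz' _] /and3P[/= le_a' le_b' _]] exx'.
  have nji : j != i by rewrite neq_ltn lt_ij orbT.
  have nji' : j' != i' by rewrite neq_ltn lt_ij' orbT.
  have L : leads w i j (upd z i j a b).
    by apply: corner_leads cz _ _ _ => [||k ki kj]; rewrite ?upd_i ?upd_j ?upd_k.
  have L' : leads w i' j' (upd z i j a b).
    by rewrite exx'; apply: corner_leads cz' _ _ _ => [||k ki kj]; rewrite ?upd_i ?upd_j ?upd_k.
  have [ei ej] := leads_uniq2 lt_ij lt_ij' L L'; subst i' j'.
  have <- : a = a' by have /ffunP/(_ i) := exx'; rewrite !upd_i.
  have <- : b = b' by have /ffunP/(_ j) := exx'; rewrite !upd_j.
  have <- // : z = z'.
  apply: corner_uniq cz cz' _ => k ki kj.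
  by have /ffunP/(_ k) := exx'; rewrite !upd_k.
rewrite -(card_in_imset f_inj); apply/subset_leq_card/subsetP => x /imsetP[u uV ->].
by move: uV; rewrite inE => /andP[_ /and3P[]].
Qed.

Lemma upd_le (z : pt) i j (a b a' b' : 'I_n) k : a <= a' -> b <= b' ->
  upd z i j a b k <= upd z i j a' b' k.
Proof. by move=> la lb; rewrite !ffunE; do 2?case: ifP. Qed.

(** The columns that reach a form an initial segment from z_j, whose length is a tail sum of [code].
    The initial segment argument is used along j, then along i. *)
Lemma mem_slice S (z : pt) i j (a b : 'I_n) : lower_set S -> z i <= a -> z j <= b ->
  (upd z i j a b \in S) = (b - z j < \sum_(k < n | a - z i <= k) code S (z, (i, j)) k).
Proof.
move=> /lower_setP lowS le_a le_b; rewrite sum_code_tail.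
rewrite (@mem_initial_segment _ (z j) (fun b => upd z i j a b \in S)) //; last first.
  by move=> b1 b2 _ le12 in2; apply: lowS in2 _ => k; apply: upd_le.
congr (_ < _); apply: eq_card => b'; rewrite !inE.
have [le_b'|nle_b'] := boolP (z j <= b'); last first.
  rewrite /height (_ : [set a0 | _] = set0) ?cards0 //; apply/setP => a0.
  by rewrite !inE /in_slice /= (negbTE nle_b') andbF.
rewrite (@mem_initial_segment _ (z i) (fun a => upd z i j a b' \in S)) //; last first.
  by move=> a1 a2 _ le12 in2; apply: lowS in2 _ => k; apply: upd_le.
by congr (_ < _); apply: eq_card => a'; rewrite !inE /in_slice /= le_b'.
Qed.

(** Each x in S lies above the corner of its own quadrant, which is in S as S is a lower set; the
    code at that corner decides whether x is in S'. *)
Lemma code_inj S S' : 2 <= d -> lower_set S -> lower_set S' ->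
  corners S = corners S' -> {in corners S, forall e, code S e =1 code S' e} -> S = S'.
Proof.
move=> d2; suff sub T T' : lower_set T -> lower_set T' -> corners T = corners T' ->
    {in corners T, forall e, code T e =1 code T' e} -> T \subset T'.
  move=> lS lS' eS eC; apply/eqP; rewrite eqEsubset !sub // => e.
  by rewrite -eS => /eC eq k.
move=> lT lT' eT eC; apply/subsetP => x xT.
have [i [j [lt_ij L]]] := leads_exist w_inj x d2.
have nij : i != j by rewrite neq_ltn lt_ij.
have [z [cz le_i le_j e]] := corner_exist nij L.
have zT : z \in T.
  move/lower_setP: (lT); apply; first exact: xT.
  move=> k; have [->//|ki] := eqVneq k i; have [->//|kj] := eqVneq k j.
  by rewrite e.
have cT : (z, (i, j)) \in corners T by rewrite inE /= lt_ij cz.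
move: xT; rewrite -(upd_id e) !mem_slice //; congr (_ < _).
by apply: eq_bigr => k _; apply: eC.
Qed.

End Code.

(** A set of at most N elements is listed by a function from ['I_N] to [option U], padded with
    [None]. *)
Lemma card_small_sets (U : finType) N : #|[set E : {set U} | #|E| <= N]| <= #|U|.+1 ^ N.
Proof.
pose f (g : {ffun 'I_N -> option U}) := [set u | Some u \in codom g].
apply: (@leq_trans #|f @: [set: {ffun 'I_N -> option U}]|); last first.
  by apply: leq_trans (leq_imset_card _ _) _; rewrite cardsT card_ffun card_option card_ord.
apply/subset_leq_card/subsetP => E; rewrite inE => leN.
apply/imsetP; exists [ffun i : 'I_N => nth None (map Some (enum E)) i] => //.
apply/setP => u; rewrite inE; apply/idP/idP => [uE|/codomP[i]].
  have lt : index u (enum E) < N.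
    by apply: leq_trans leN; rewrite cardE index_mem mem_enum.
  apply/codomP; exists (Ordinal lt); rewrite ffunE /= (nth_map u) ?nth_index ?mem_enum //.
  by rewrite index_mem mem_enum.
rewrite ffunE; have [lt_i|ge_i] := ltnP i (size (enum E)).
  by rewrite (nth_map u) // => -[->]; rewrite -mem_enum mem_nth.
by rewrite nth_default // size_map.
Qed.

(** * Counting lower sets with few corners *)

Section Weights.

Import Order.TTheory GRing.Theory Num.Theory.
Local Open Scope ring_scope.

Variables (F : realFieldType) (d n : nat) (w : 'I_d * 'I_n -> nat) (q : F).
Hypotheses (w_inj : injective w) (d2 : (2 <= d)%N) (q_ge0 : 0 <= q) (q_le1 : q <= 1).
Notation corner_t := (box d n * ('I_d * 'I_d))%type.

(** Truncated Euler product: the generating function of partitions with parts at most n, each used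
    at most n times. *)
Definition young_gf : F := \prod_(k < n) \sum_(c < n.+1) q ^+ (k.+1 * c).

Lemma young_gf_ge1 : 1 <= young_gf.
Proof.
rewrite /young_gf; elim/big_ind: _ => // [x y x1 y1|k _]; first by rewrite -[1]mulr1 ler_pM.
by rewrite big_ord_recl muln0 expr0 lerDl sumr_ge0 // => c _; apply: exprn_ge0.
Qed.

(** Expanding the power of [young_gf] gives one term per family of codes. Distinct S use distinct
    terms, each at least q^n since the diagrams have total size at most n and q <= 1. *)
Lemma card_fixed_corners (E : {set corner_t}) :
  #|[set S : {set box d n} | [&& lower_set S, #|S| == n & corners w S == E]]|%:R * q ^+ n
    <= young_gf ^+ #|E|.
Proof.
set fam := [set S | _].
(* Outside E the factor forces c = 0, so that the product can be distributed over all index pairs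
   uniformly. *)
pose G (u : corner_t * 'I_n) (c : 'I_n.+1) : F :=
  if u.1 \in E then q ^+ (u.2.+1 * c) else (c == ord0)%:R.
have G_ge0 u c : 0 <= G u c by rewrite /G; case: ifP => _; rewrite ?exprn_ge0 ?ler0n.
pose h (S : {set box d n}) : {ffun corner_t * 'I_n -> 'I_n.+1} :=
  [ffun u => if u.1 \in E then inord (code S u.1 u.2) else ord0].
have h_inj : {in fam &, injective h}.
  move=> S S'; rewrite !inE => /and3P[lS _ /eqP eS] /and3P[lS' _ /eqP eS'] /ffunP e.
  apply: (code_inj w_inj) => //; first by rewrite eS.
  move=> c; rewrite eS => cE k; have /(congr1 val) := e (c, k).
  by rewrite !ffunE /= cE /= !inordK // ltnS code_le.
have -> : young_gf ^+ #|E| = \prod_u \sum_c G u c.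
  rewrite (eq_bigr (fun u : corner_t * 'I_n => (if u.1 \in E then \sum_(c < n.+1) q ^+ (u.2.+1 * c) else 1))).
    rewrite -(pair_bigA _ (fun e (k : 'I_n) => if e \in E then \sum_(c < n.+1) q ^+ (k.+1 * c) else 1)) /=.
    rewrite -prodr_const big_mkcond; apply: eq_bigr => e _.
    by case: ifP => // _; rewrite big1.
  move=> u _; rewrite /G; case: ifP => // _.
  by rewrite (bigD1 ord0) //= big1 ?addr0 // => c /negbTE ->.
rewrite bigA_distr_bigA /=.
apply: (@le_trans _ _ (\sum_(g in h @: fam) \prod_u G u (g u))); last first.
  rewrite [leRHS](bigID (mem (h @: fam))) /= lerDl sumr_ge0 // => g _.
  by apply: prodr_ge0.
rewrite big_imset //= mulr_natl -sumr_const; apply: ler_sum => S.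
rewrite inE => /and3P[lS /eqP cS /eqP eS].
have -> : \prod_u G u (h S u) = q ^+ (\sum_(e in E) \sum_(k < n) k.+1 * code S e k).
  rewrite expr_sum [RHS]big_mkcond /=.
  rewrite (eq_bigr (fun u => G (u.1, u.2) (h S (u.1, u.2)))); last by case.
  rewrite -(pair_bigA _ (fun e k => G (e, k) (h S (e, k)))) /=.
  apply: eq_bigr => e _; rewrite expr_sum; case: ifP => eE; last first.
    by rewrite big1 // => k _; rewrite /G ffunE /= eE.
  by apply: eq_bigr => k _; rewrite /G ffunE /= eE inordK // ltnS code_le.
by rewrite ler_wiXn2l //; have := sum_code_corners w S; rewrite eS cS.
Qed.

Lemma card_few_corners N :
  #|[set S : {set box d n} | [&& lower_set S, #|S| == n & (#|corners w S| <= N)%N]]|%:R * q ^+ n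
    <= #|{: corner_t}|.+1%:R ^+ N * young_gf ^+ N.
Proof.
set fam := [set S | _].
have -> : #|fam| = (\sum_(E : {set corner_t} | #|E| <= N)
    #|[set S : {set box d n} | [&& lower_set S, #|S| == n & corners w S == E]]|)%N.
  rewrite -sum1_card (partition_big (corners w) (fun E => #|E| <= N)%N) /=; last first.
    by move=> S; rewrite inE => /and3P[].
  apply: eq_bigr => E leE; rewrite -sum1_card; apply: eq_bigl => S; rewrite !inE.
  by case: (corners w S =P E) => [->|_]; rewrite ?leE ?andbT ?andbF //=.
rewrite natr_sum mulr_suml.
apply: (@le_trans _ _ (\sum_(E : {set corner_t} | (#|E| <= N)%N) young_gf ^+ N)).
  apply: ler_sum => E leE; apply: le_trans (card_fixed_corners E) _.
  by rewrite ler_weXn2l // young_gf_ge1.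
rewrite sumr_const -[leLHS]mulr_natl; apply: ler_wpM2r.
  by rewrite exprn_ge0 // (le_trans ler01) // young_gf_ge1.
rewrite -natrX ler_nat -(eq_card (_ : [set E : {set corner_t} | (#|E| <= N)%N] =i _)) ?card_small_sets //.
by move=> E; rewrite inE.
Qed.

End Weights.

(** * Random rankings *)

Section RandomRanking.

Variable T : finType.
Implicit Types (A : {set T}) (a b t : T) (s : {perm T}).

Definition rank_of s t : nat := enum_rank (s t).

Lemma rank_of_inj s : injective (rank_of s).
Proof. by move=> a b /val_inj/enum_rank_inj/perm_inj. Qed.

Definition two_least A a b s :=
  [forall t in A, (t != a) && (t != b) ==>
    (rank_of s a < rank_of s t) && (rank_of s b < rank_of s t)].

Lemma two_leastP A a b s :
  reflect (forall t, t \in A -> t != a -> t != b ->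
             rank_of s a < rank_of s t /\ rank_of s b < rank_of s t)
          (two_least A a b s).
Proof.
apply: (iffP 'forall_implyP) => H t tA => [ta tb|].
  by apply/andP; apply: (implyP (H t tA)); rewrite ta.
by apply/implyP => /andP[ta tb]; apply/andP/H.
Qed.

Lemma two_least_uniq A a b a' b' s : a \in A -> b \in A -> a' != b' ->
  two_least A a b s -> two_least A a' b' s -> a' \in A -> b' \in A ->
  (a == a') || (a == b').
Proof.
move=> aA bA nab' /two_leastP H /two_leastP H' a'A b'A.
apply/contraT; rewrite negb_or => /andP[naa' nab''].
have [lt_a' lt_b'] := H' a aA naa' nab''.
have e t : t \in A -> rank_of s t < rank_of s a -> t = b.
  move=> tA lt_t; apply/eqP/contraT => tb.
  have ta : t != a by apply: contraTneq lt_t => ->; rewrite ltnn.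
  by have [] := H t tA ta tb; rewrite ltnNge ltnW.
by rewrite (e a') // (e b') // eqxx in nab'.
Qed.

Lemma two_least_sym A a b s : two_least A a b s = two_least A b a s.
Proof.
by apply/two_leastP/two_leastP => H t tA ta tb; case: (H t tA tb ta).
Qed.

(** Composing rankings with a permutation of T that preserves A and sends a' to a and b' to b is
    injective. *)
Lemma card_two_least_le A a b a' b' : a \in A -> b \in A -> a != b ->
  a' \in A -> b' \in A -> a' != b' ->
  #|[set s | two_least A a b s]| <= #|[set s | two_least A a' b' s]|.
Proof.
move=> aA bA nab a'A b'A nab'.
(* The first transposition puts a' in place and moves b' to [c]; the second sends [c] to b without
   touching a. *)
pose c := tperm a' a b'; pose u := (tperm a' a * tperm c b)%g.
have tpA x y t : x \in A -> y \in A -> t \in A -> tperm x y t \in A.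
  by move=> xA yA tA; case: tpermP.
have cA : c \in A by apply: tpA.
have nca : c != a by rewrite -(tpermL a' a) (inj_eq perm_inj) eq_sym.
have ua : u a' = a by rewrite permM tpermL tpermD // eq_sym.
have ub : u b' = b by rewrite permM tpermL.
rewrite -(card_imset (mem [set s | two_least A a b s]) (mulgI u)).
apply/subset_leq_card/subsetP => _ /imsetP[s + ->]; rewrite !inE => /two_leastP H.
apply/two_leastP => t tA ta tb; rewrite /rank_of !(permM u s) ua ub.
apply: H; last 2 first.
- by rewrite -ua (inj_eq perm_inj).
- by rewrite -ub (inj_eq perm_inj).
by rewrite permM !tpA.
Qed.

(** Double counting: all ordered pairs from A are equally likely to be the two least, and each
    ranking has at most two such ordered pairs. *)
Lemma card_two_least A a b : a \in A -> b \in A -> a != b ->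
  #|[set s | two_least A a b s]| * (#|A| * #|A|.-1) <= 2 * #|{: {perm T}}|.
Proof.
move=> aA bA nab; pose D := [set p : T * T | [&& p.1 \in A, p.2 \in A & p.1 != p.2]].
have cardD : #|D| = #|A| * #|A|.-1.
  rewrite /D cardsE -sum1_card -(pair_big_dep (mem A) (fun x y => (y \in A) && (x != y)) (fun _ _ => 1)) /=.
  rewrite -sum_nat_const; apply: eq_bigr => x xA.
  rewrite sum1_card [in RHS](cardsD1 x A) xA /=; apply: eq_card => y.
  by rewrite !inE andbC eq_sym.
apply: (@leq_trans (\sum_(p in D) #|[set s | two_least A p.1 p.2 s]|)).
  rewrite -cardD mulnC -sum_nat_const; apply: leq_sum => -[a' b'].
  by rewrite inE /= => /and3P[a'A b'A nab']; apply: card_two_least_le.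
have -> : \sum_(p in D) #|[set s | two_least A p.1 p.2 s]| =
          \sum_(s : {perm T}) #|[set p in D | two_least A p.1 p.2 s]|.
  transitivity (\sum_(p in D) \sum_(s : {perm T} | two_least A p.1 p.2 s) 1).
    by apply: eq_bigr => p _; rewrite sum1_card cardsE.
  rewrite (exchange_big_dep predT) //=; apply: eq_bigr => s _.
  by rewrite sum1_card cardsE.
rewrite mulnC -sum_nat_const; apply: leq_sum => s _.
have [->|[[x y]]] := set_0Vmem [set p in D | two_least A p.1 p.2 s]; first by rewrite cards0.
rewrite !inE /= => /andP[/and3P[xA yA nxy] lxy].
apply: (@leq_trans #|[set (x, y); (y, x)]|); last by rewrite cards2 ltnS leq_b1.
apply/subset_leq_card/subsetP => -[x' y']; rewrite !inE /=.
move=> /andP[/and3P[x'A y'A nxy'] lxy'].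
have e1 := two_least_uniq xA yA nxy' lxy lxy' x'A y'A.
have e2 : (y == x') || (y == y').
  by apply: two_least_uniq yA xA nxy' _ lxy' x'A y'A; rewrite two_least_sym.
rewrite !xpair_eqE; case/orP: e1 e2 => /eqP e1 /orP[] /eqP e2; subst => //.
- by rewrite eqxx in nxy.
- by rewrite !eqxx.
- by rewrite !eqxx orbT.
- by rewrite eqxx in nxy.
Qed.

End RandomRanking.

Definition weight d n (z : box d n) := \sum_(k < d) (z k).+1.

Lemma card_below d n (z : box d n) : #|below z| = weight z.
Proof.
rewrite /below cardsE -sum1_card /weight.
rewrite -(pair_big_dep xpredT (fun k (a : 'I_n) => a <= z k) (fun _ _ => 1)) /=.
apply: eq_bigr => k _; rewrite sum1_card.
have := @card_ord_interval n 0 (z k).+1 (ltn_ord _); rewrite subn0 => <-.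
by rewrite cardsE; apply: eq_card => a.
Qed.

Lemma weight_ge d n (z : box d n) : d <= weight z.
Proof.
rewrite /weight -[X in X <= _]muln1 -[X in X * _ <= _]card_ord -sum_nat_const.
exact: leq_sum.
Qed.

(** * Averaging over rankings *)

Section Averaging.

Variables (d n : nat).
Hypothesis d2 : 2 <= d.
Notation ranking := {perm 'I_d * 'I_n}.

Lemma card_corner (i j : 'I_d) (z : box d n) : i < j ->
  #|[set s : ranking | corner (rank_of s) i j z]| * (weight z * (weight z).-1)
    <= 2 * #|{: ranking}|.
Proof.
move=> lt_ij; have nij : i != j by rewrite neq_ltn lt_ij.
have nji : j != i by rewrite eq_sym.
rewrite -card_below.
have iA : (i, z i) \in below z by rewrite inE /=.
have jA : (j, z j) \in below z by rewrite inE /=.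
have nab : (i, z i) != (j, z j) by rewrite xpair_eqE (negbTE nij).
apply: leq_trans (card_two_least iA jA nab); rewrite leq_mul2r; apply/orP; right.
apply/subset_leq_card/subsetP => s; rewrite !inE => c.
apply/two_leastP => t tA ti tj; split.
  by apply: corner_tip c tA ti tj => //; apply: rank_of_inj.
rewrite corner_sym in c.
by apply: corner_tip c tA tj ti => //; apply: rank_of_inj.
Qed.

Import Order.TTheory GRing.Theory Num.Theory.
Local Open Scope ring_scope.

Variable F : realFieldType.

(** Linearity of expectation: each of the d (d - 1) / 2 pairs i < j makes z a corner with
    probability at most 2 / (W (W - 1)), W the weight of z. *)
Lemma sum_corners (S : {set box d n}) :
  (\sum_(s : ranking) #|corners (rank_of s) S|)%N%:R <=
  #|{: ranking}|%:R * \sum_(z in S) (d * d.-1)%:R / (weight z * (weight z).-1)%:R :> F.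
Proof.
have cE s : #|corners (rank_of s) S| =
    (\sum_(z in S) \sum_(ij : 'I_d * 'I_d | ij.1 < ij.2) corner (rank_of s) ij.1 ij.2 z)%N.
  rewrite /corners cardsE -sum1_card big_mkcond /=.
  rewrite (eq_bigr (fun e : box d n * ('I_d * 'I_d) => if e.1 \in S then
     if (e.2.1 < e.2.2)%N then (corner (rank_of s) e.2.1 e.2.2 e.1 : nat) else 0%N else 0%N)); last first.
    by move=> e _; rewrite unfold_in; case: (e.1 \in S); case: (e.2.1 < e.2.2)%N; case: (corner _ _ _ _).
  rewrite -(pair_bigA _ (fun z (ij : 'I_d * 'I_d) => if z \in S then if (ij.1 < ij.2)%N
     then (corner (rank_of s) ij.1 ij.2 z : nat) else 0%N else 0%N)) /=.
  rewrite [RHS]big_mkcond; apply: eq_bigr => z _; case: ifP => _; last by rewrite big1.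
  by rewrite [RHS]big_mkcond.
rewrite (eq_bigr _ (fun s _ => cE s)) exchange_big natr_sum mulr_sumr.
apply: ler_sum => z _; rewrite exchange_big /=.
have w_gt0 : 0 < (weight z * (weight z).-1)%:R :> F.
  rewrite ltr0n muln_gt0; have := leq_trans d2 (weight_ge z).
  by case: (weight z) => [|[]].
rewrite mulrA ler_pdivlMr // -!natrM ler_nat big_distrl /=.
apply: (@leq_trans (\sum_(ij : 'I_d * 'I_d | ij.1 < ij.2) 2 * #|{: ranking}|)%N).
  apply: leq_sum => ij lt_ij; apply: leq_trans (card_corner z lt_ij).
  rewrite leq_mul2r; apply/orP; right.
  by rewrite cardsE -sum1_card [leqRHS]big_mkcond; apply: leq_sum.
rewrite sum_nat_const mulnA mulnC leq_mul2l; apply/orP; right.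
rewrite -sum1_card.
rewrite (eq_bigl (fun ij : 'I_d * 'I_d => true && (ij.1 < ij.2)%N)) //.
rewrite -(pair_big_dep xpredT (fun i j : 'I_d => i < j)%N (fun _ _ => 1%N)) /=.
rewrite (exchange_big_dep predT) //=.
under eq_bigr => j _ do rewrite sum1_card -(cardsE (fun i : 'I_d => i < j)%N).
rewrite (eq_bigr (fun j : 'I_d => j : nat)); last first.
  by move=> j _; have := @card_ord_interval d 0 j (ltnW (ltn_ord j)); rewrite subn0.
by rewrite -(big_mkord xpredT id) bin2_sum bin2 muln2 -{2}(odd_double_half (d * d.-1)) leq_addl.
Qed.

(** By Markov's inequality, a mean of at most N / 2 corners leaves at least half of the rankings
    with at most N. Then the pairs of a lower set and a good ranking are counted in two ways. *)
Lemma p_le_few_corners (N : nat) (X : F) :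
  (forall s : ranking, #|[set S : {set box d n} |
     [&& lower_set S, #|S| == n & (#|corners (rank_of s) S| <= N)%N]]|%:R <= X) ->
  (forall S : {set box d n}, lower_set S -> #|S| = n ->
     (2 * \sum_(s : ranking) #|corners (rank_of s) S| <= N * #|{: ranking}|)%N) ->
  (p d n)%:R <= 2 * X.
Proof.
move=> HX HS; pose P := #|{: ranking}|.
have P_gt0 : (0 < P)%N by apply/card_gt0P; exists 1%g.
have good S : lower_set S -> #|S| = n ->
    (P <= 2 * #|[set s : ranking | #|corners (rank_of s) S| <= N]|)%N.
  move=> lS cS; set G := [set s | _].
  have : (#|~: G| * N.+1 <= \sum_(s : ranking) #|corners (rank_of s) S|)%N.
    rewrite -sum_nat_const big_mkcond; apply: leq_sum => s _.
    by case: ifP; rewrite // !inE -ltnNge.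
  have := HS S lS cS; have := cardsC G; rewrite -/P; nia.
have : (P * p d n <= 2 * \sum_(s : ranking) #|[set S : {set box d n} |
     [&& lower_set S, #|S| == n & (#|corners (rank_of s) S| <= N)]]|)%N.
  rewrite /p mulnC -sum_nat_const.
  apply: (@leq_trans (\sum_(S in [set S : {set box d n} | lower_set S & (#|S| == n)])
     2 * #|[set s : ranking | #|corners (rank_of s) S| <= N]|)%N).
    by apply: leq_sum => S; rewrite inE => /andP[lS /eqP cS]; apply: good.
  rewrite -big_distrr leq_mul2l /=.
  under eq_bigr => S _ do rewrite cardsE -sum1_card.
  rewrite (exchange_big_dep predT) //=; apply: leq_sum => s _.
  rewrite sum1_card; apply/subset_leq_card/subsetP => S.
  by rewrite unfold_in /= !inE => /andP[/andP[lS cS] sN]; rewrite lS cS; apply: sN.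
rewrite -(@ler_nat F) !natrM natr_sum => le1.
have P0 : 0 < P%:R :> F by rewrite ltr0n.
rewrite -(ler_pM2l P0); apply: le_trans le1 _.
rewrite mulrCA ler_pM2l // mulr_natl -sumr_const.
by apply: ler_sum => s _; apply: HX.
Qed.

End Averaging.

(** * The expected number of corners *)

(** Stars and bars; [s < n] keeps the box from cutting off the layer. *)
Lemma card_layer d n s : s < n ->
  #|[set z : box d.+1 n | \sum_k (z k : nat) == s]| = 'C(d + s, d).
Proof.
move=> lt_sn; rewrite -card_ord_partitions.
pose f (t : d.+1.-tuple 'I_s.+1) : box d.+1 n := [ffun k => widen_ord lt_sn (tnth t k)].
have f_inj : injective f.
  move=> t t' /ffunP e; apply: eq_from_tnth => k; apply/val_inj.
  by have /(congr1 val) := e k; rewrite !ffunE.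
have sum_f t : \sum_k (f t k : nat) = \sum_(i <- t) i.
  by rewrite big_tuple; apply: eq_bigr => k _; rewrite ffunE.
rewrite -(card_imset _ f_inj); apply: eq_card => z; rewrite inE.
apply/idP/imsetP => [/eqP ez|[t + ->]]; last by rewrite inE sum_f.
have ez' : z = f [tuple inord (z k) | k < d.+1].
  apply/ffunP => k; rewrite ffunE tnth_mktuple; apply/val_inj.
  by rewrite /= inordK // ltnS -ez (bigD1 k) //= leq_addr.
by exists [tuple inord (z k) | k < d.+1]; rewrite // inE -sum_f -ez' ez.
Qed.

Lemma leq_exp2r_weak m m' k : m <= m' -> m ^ k <= m' ^ k.
Proof. by case: k => // k le_m; rewrite leq_exp2r. Qed.

Lemma ffact_le_exp m k : m ^_ k <= m ^ k.
Proof.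
elim: k m => // k IH m; rewrite ffactnS expnS leq_mul2l; apply/orP; right.
by apply: leq_trans (IH _) _; case: k {IH} => // k; rewrite leq_exp2r // leq_pred.
Qed.

Lemma lt_bin m d : 0 < d -> m < 'C(m + d, d).
Proof.
case: d => // d _; elim: d => [|e IH]; first by rewrite addn1 bin1.
by apply: leq_trans IH _; rewrite !addnS binS leq_addl.
Qed.

Lemma sum_bin_diag t e : \sum_(s < t) 'C(s + e, e) = 'C(t + e, e.+1).
Proof.
elim: t => [|t IH]; first by rewrite big_ord0 add0n bin_small.
by rewrite big_ord_recr /= IH addSn binS.
Qed.

(** Integer form of (1 + 1/d)^k <= 1 + k/d + (k/d)^2; at k = d it gives (1 + 1/d)^d <= 3. *)
Lemma succ_exp_le d k : k <= d -> (d.+1) ^ k * d ^ 2 <= d ^ k * (d ^ 2 + k * d + k ^ 2).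
Proof.
elim: k => [|k IH] lt_kd; first by rewrite !expn0 mul1n mul1n mul0n !addn0.
have {}IH := IH (ltnW lt_kd); rewrite !(expnS _ k) -mulnA.
apply: (@leq_trans (d.+1 * (d ^ k * (d ^ 2 + k * d + k ^ 2)))); first by rewrite leq_mul2l IH orbT.
have -> : d.+1 * (d ^ k * (d ^ 2 + k * d + k ^ 2)) = d ^ k * (d.+1 * (d ^ 2 + k * d + k ^ 2)) by lia.
rewrite -mulnA [leqRHS]mulnCA leq_mul2l; apply/orP; right.
rewrite !expnS !expn0 !muln1; nia.
Qed.

(** Crude Stirling bound: each induction step costs a factor (1 + 1/d)^d <= 3. *)
Lemma exp_self_le_fact d : d ^ d <= 3 ^ d * d`!.
Proof.
elim: d => // -[|d] IH //.
have : d.+2 ^ d.+1 <= 3 * d.+1 ^ d.+1.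
  have := succ_exp_le (leqnn d.+1).
  rewrite (_ : d.+1 ^ 2 + d.+1 * d.+1 + d.+1 ^ 2 = 3 * d.+1 ^ 2); last by rewrite !expnS expn0; lia.
  by rewrite mulnA leq_pmul2r // mulnC.
move=> le3; rewrite expnS (expnS 3) factS.
have -> : 3 * 3 ^ d.+1 * (d.+2 * d.+1`!) = d.+2 * (3 * (3 ^ d.+1 * d.+1`!)) by lia.
by rewrite leq_mul2l; apply: leq_trans le3 _; rewrite leq_mul2l.
Qed.

(** Each induction step gains (1 + 1/d)^d >= 2 >= 8/5, by Bernoulli. The base d = 3 is computed; the
    bound fails at d = 2. *)
Lemma fact_le_exp_self d : 3 <= d -> 8 ^ d * d`! <= 5 ^ d * d ^ d.
Proof.
elim: d => // d IH; rewrite ltnS leq_eqVlt => /orP[/eqP <- //|d3].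
have bern k : d ^ k + k * d ^ k.-1 <= d.+1 ^ k.
  elim: k => // -[|k] IHk; first by rewrite !expn1 expn0; lia.
  rewrite (expnS d.+1); apply: leq_trans (leq_mul (leqnn d.+1) IHk).
  rewrite /= !expnS; nia.
have {bern}b : 2 * d ^ d <= d.+1 ^ d.
  by have := bern d; rewrite -expnS (ltn_predK d3) mul2n addnn.
have {}IH := IH d3; rewrite factS !(expnS _ d).
have -> : 8 * 8 ^ d * (d.+1 * d`!) = 8 * d.+1 * (8 ^ d * d`!) by lia.
apply: (@leq_trans (8 * d.+1 * (5 ^ d * d ^ d))); first by rewrite leq_mul2l IH orbT.
have -> : 8 * d.+1 * (5 ^ d * d ^ d) = d.+1 * 5 ^ d * (8 * d ^ d) by lia.
have -> : 5 * 5 ^ d * (d.+1 * d.+1 ^ d) = d.+1 * 5 ^ d * (5 * d.+1 ^ d) by lia.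
by rewrite leq_mul2l; apply/orP; right; lia.
Qed.

Lemma weightE d n (z : box d n) : weight z = \sum_k (z k : nat) + d.
Proof.
by rewrite /weight (eq_bigr (fun k => z k + 1)) ?big_split /= ?sum1_card ?card_ord // => k _; rewrite addn1.
Qed.

(** For d = e + 3, lowering the binomial twice leaves the factor (e + 3) / (e + 1) <= 3. *)
Lemma layer_weight_le e s :
  'C(e.+2 + s, e.+2) * (e.+3 * e.+2) <= 3 * 'C(s + e, e) * ((s + e.+3) * (s + e.+2)).
Proof.
have h1 := mul_bin_diag (e.+2 + s) e.+1.
have h2 := mul_bin_diag (e.+1 + s) e.
rewrite !addSn /= in h1 h2 *; rewrite (addnC s e).
set c2 := 'C((e + s).+2, e.+2) in h1 *; set c1 := 'C((e + s).+1, e.+1) in h1 h2.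
set c0 := 'C(e + s, e) in h2 *.
rewrite -(leq_pmul2r (ltn0Sn e)).
have -> : c2 * (e.+3 * e.+2) * e.+1 = e.+3 * (e.+1 * (e.+2 * c2)) by lia.
rewrite -h1 (_ : e.+3 * (e.+1 * ((e + s).+2 * c1)) = e.+3 * (e + s).+2 * (e.+1 * c1)); last by lia.
rewrite -h2.
nia.
Qed.

Section WeightSum.

Import Order.TTheory GRing.Theory Num.Theory.
Local Open Scope ring_scope.

(** Grouped by layers, the sum telescopes into a single binomial coefficient by the hockey-stick
    identity. *)
Lemma sum_light_le (F : realFieldType) d n M (T : {set box d n}) : (2 < d)%N -> (d * (M %/ 3) <= n)%N ->
  (forall z, z \in T -> (weight z < d * (M %/ 3))%N) ->
  \sum_(z in T) (d * d.-1)%:R / (weight z * (weight z).-1)%:R <= 27 * M%:R ^+ (d - 2) :> F.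
Proof.
case: d T => [|[|[|e]]] // T _ le_n light; set K := (M %/ 3)%N in le_n light.
(* The weight exceeds the coordinate sum by d, so light points have coordinate sum below [t]. *)
pose t := (e.+3 * K - e.+3)%N.
pose g s : F := (e.+3 * e.+2)%:R / ((s + e.+3) * (s + e.+2))%:R.
have g_ge0 s : 0 <= g s by rewrite divr_ge0 // ler0n.
apply: (@le_trans _ _ (\sum_(s < t) \sum_(z : box e.+3 n | (\sum_k (z k : nat) == s)%N) g s)).
  rewrite (exchange_big_dep predT) //= [leLHS]big_mkcond; apply: ler_sum => z _.
  case: ifP => [zT|_]; last by apply: sumr_ge0.
  have lt_t : (\sum_k (z k : nat) < t)%N by have := light z zT; rewrite weightE /t; lia.
  rewrite (bigD1 (Ordinal lt_t)) //= ler_wpDr ?sumr_ge0 //.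
  by rewrite /g weightE addnS.
apply: (@le_trans _ _ (\sum_(s < t) (3 * 'C(s + e, e))%:R)).
  apply: ler_sum => s _; rewrite sumr_const -(cardsE (fun z : box e.+3 n => \sum_k (z k : nat) == s)%N).
  have lt_sn : (s < n)%N by apply: leq_trans (ltn_ord s) (leq_trans (leq_subr _ _) le_n).
  rewrite card_layer // /g -[leLHS]mulr_natl mulrA ler_pdivrMr; last by rewrite ltr0n muln_gt0 !addnS.
  by rewrite -!natrM ler_nat layer_weight_le.
rewrite -natr_sum -big_distrr /= sum_bin_diag.
rewrite !subSS subn0 -natrX -natrM ler_nat -[27%N]/(3 * 9)%N -mulnA leq_mul2l /=.
have [K0|K_gt0] := posnP K; first by rewrite /t K0 muln0 sub0n add0n bin_small.
have le_t : (t + e <= e.+3 * K)%N by rewrite /t; nia.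
have le3K : (3 * K <= M)%N by rewrite mulnC leq_trunc_div.
(* From d^d <= 3^d d! one gets d^(d-2) <= 9 * 3^(d-2) (d-2)!, whence the 9. *)
apply: (@leq_trans (9 * (3 * K) ^ e.+1)); last by rewrite leq_mul2l leq_exp2r.
rewrite -(leq_pmul2r (fact_gt0 e.+1)) bin_ffact.
apply: leq_trans (ffact_le_exp _ _) _.
apply: (@leq_trans ((e.+3 * K) ^ e.+1)); first by rewrite leq_exp2r.
rewrite !expnMn -mulnA mulnAC mulnA leq_mul2r; apply/orP; right.
have := exp_self_le_fact e.+3; rewrite (expnS e.+3) (expnS e.+3) 2!(expnS 3) 2!factS.
nia.
Qed.

(** The points are split at weight d K, K = M / 3 rounded down. Light ones give 27 M^(d-2). As M >=
    6 implies M <= 4 K, a heavy one gives at most 1 / K^2 <= 16 / M^2, and there are at most 2 M^d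
    of them: 32 <= 33. *)
Lemma sum_weight_le (F : realFieldType) d n M (S : {set box d n}) : (2 < d)%N -> (d <= M)%N ->
  (6 <= M)%N -> (M ^ d <= n)%N -> (n <= 2 * M ^ d)%N -> #|S| = n ->
  \sum_(z in S) (d * d.-1)%:R / (weight z * (weight z).-1)%:R <= 60 * M%:R ^+ (d - 2) :> F.
Proof.
move=> d3 le_dM M6 le_Mn le_nM cardS; set K := (M %/ 3)%N.
have M2 : (M ^ d = M ^ (d - 2) * M ^ 2)%N by rewrite -expnD subnK // ltnW.
have M0 : 0 < M%:R :> F by rewrite ltr0n; lia.
pose light := [pred z : box d n | (weight z < d * K)%N].
rewrite (bigID light) /= (_ : 60 = 27 + 33 :> F); last by ring.
rewrite mulrDl lerD //.
  rewrite (eq_bigl (mem [set z in S | light z])) => [|z]; last by rewrite /= inE.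
  apply: sum_light_le => // [|z].
    apply: leq_trans le_Mn; apply: (@leq_trans (M * M ^ 1)%N).
      by rewrite expn1 leq_mul // leq_div.
    by rewrite -expnS leq_exp2l //; lia.
  by rewrite !inE => /andP[].
apply: (@le_trans _ _ (\sum_(z in S) 16 / M%:R ^+ 2)).
  rewrite [leLHS]big_mkcond [leRHS]big_mkcond; apply: ler_sum => z _.
  case: (z \in S) => //=; case: ltnP => [_|heavy]; first by rewrite divr_ge0 // exprn_ge0.
  have M4 : (M <= 4 * K)%N by rewrite /K; lia.
  have K1 : (0 < K)%N by rewrite /K; lia.
  rewrite ler_pdivrMr; last first.
    by rewrite ltr0n muln_gt0; have := weight_ge z; case: (weight z) => [|[]] //; lia.
  rewrite mulrAC ler_pdivlMr ?exprn_gt0 // -natrX -!natrM ler_nat.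
  apply: (@leq_trans (d * d.-1 * (16 * (K * K)))).
    by rewrite leq_mul2l -[16%N]/(4*4)%N mulnACA expnS expn1 leq_mul // orbT.
  rewrite (_ : d * d.-1 * (16 * (K * K)) = 16 * ((d * K) * (d.-1 * K)))%N; last by lia.
  rewrite leq_mul2l leq_mul //=.
  by case: (weight z) heavy => [|v] /=; nia.
rewrite sumr_const cardS -[leLHS]mulr_natl mulrA ler_pdivrMr ?exprn_gt0 //.
rewrite -!natrX -mulrA -!natrM ler_nat -M2; lia.
Qed.

(** In the plane there is no third axis, so there is only one quadrant. *)
Lemma card_corners_plane n (w : 'I_2 * 'I_n -> nat) (S : {set box 2 n}) :
  (#|corners w S| <= 1)%N.
Proof.
have ord2 (i j : 'I_2) : (i < j)%N -> i = ord0 /\ j = ord_max.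
  by case: i j => [[|[]]] // i2 [[|[]]] // j2 _; split; apply/val_inj.
apply/card_le1_eqP => -[z [i j]] [z' [i' j']]; rewrite !inE /=.
move=> /and3P[/ord2[-> ->] c _] /and3P[/ord2[-> ->] c' _].
by rewrite (corner_uniq c c') // => -[[|[]]].
Qed.

Lemma sum_corners_le d n M (S : {set box d n}) : (2 <= d)%N -> (d <= M)%N ->
  (6 <= M)%N -> (M ^ d <= n)%N -> (n <= 2 * M ^ d)%N -> #|S| = n ->
  (2 * \sum_(s : {perm 'I_d * 'I_n}) #|corners (rank_of s) S|
    <= 120 * M ^ (d - 2) * #|{: {perm 'I_d * 'I_n}}|)%N.
Proof.
move=> d2 le_dM M6 le_Mn le_nM cardS.
have [d3|] := ltnP 2 d; last first.
  move=> le_d2; have ed : d = 2%N by apply/eqP; rewrite eqn_leq le_d2.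
  subst d; rewrite subnn expn0 muln1.
  apply: (@leq_trans (2 * #|{: {perm 'I_2 * 'I_n}}|)); last by rewrite leq_mul2r orbT.
  rewrite leq_mul2l /= -sum1_card; apply: leq_sum => s _.
  exact: card_corners_plane.
rewrite -(ler_nat rat) [in leLHS]natrM.
have h1 := sum_corners d2 rat S; have h2 := sum_weight_le rat d3 le_dM M6 le_Mn le_nM cardS.
have P0 : 0 <= #|{: {perm 'I_d * 'I_n}}|%:R :> rat by rewrite ler0n.
have h3 := le_trans h1 (ler_wpM2l P0 h2).
rewrite 2!natrM natrX; lra.
Qed.

End WeightSum.

(** * Estimates at q = M / (M + 1) *)

Section GeneratingFunction.

Import Order.TTheory GRing.Theory Num.Theory.
Local Open Scope ring_scope.

Variables (F : realFieldType) (M : nat).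
Hypothesis M_gt0 : (0 < M)%N.
Let q : F := M%:R / M.+1%:R.

Let M0 : 0 < M%:R :> F. Proof. by rewrite ltr0n. Qed.
Let M1 : 0 < M%:R + 1 :> F. Proof. by rewrite addr_gt0. Qed.
Let qE : q = M%:R / (M%:R + 1). Proof. by rewrite /q -natr1. Qed.
Let q0 : 0 < q. Proof. by rewrite qE divr_gt0. Qed.

(** Bernoulli's inequality (1 + 1/M)^k >= 1 + k/M, inverted. *)
Lemma q_exp_le k : q ^+ k <= M%:R / (M%:R + k%:R).
Proof.
have pos m : 0 < M%:R + m%:R :> F by rewrite ltr_wpDr.
elim: k => [|k IH]; first by rewrite expr0 addr0 divff // gt_eqF.
rewrite exprS; apply: (@le_trans _ _ (q * (M%:R / (M%:R + k%:R)))).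
  by rewrite ler_pM2l.
have := pos k; have := pos k.+1; rewrite qE -natr1 => p1 p0.
have k0 : 0 <= k%:R :> F by [].
rewrite mulf_div ler_pdivlMr // mulrAC ler_pdivrMr ?mulr_gt0 //.
by move: (M%:R) (k%:R) M0 k0 => m x m0 x0; rewrite -subr_ge0 (_ : _ - _ = m * x); [rewrite mulr_ge0 // ltW | ring].
Qed.

Lemma sum_q_exp_le n : \sum_(k < n) q ^+ k.+1 <= M%:R.
Proof.
have -> : \sum_(k < n) q ^+ k.+1 = M%:R * (1 - q ^+ n).
  elim: n => [|n IH]; first by rewrite big_ord0 subrr mulr0.
  rewrite big_ord_recr /= IH exprS; set x := q ^+ n; rewrite qE.
  by field; rewrite gt_eqF.
by apply: ler_piMr; [apply: ltW | rewrite lerBlDr lerDl exprn_ge0 // ltW].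
Qed.

Lemma geometric_le (x : F) n : 0 <= x -> x < 1 -> \sum_(c < n) x ^+ c <= (1 - x)^-1.
Proof.
move=> x0 x1; have y0 : 0 < 1 - x by rewrite subr_gt0.
rewrite -div1r ler_pdivlMr // mulrC.
have -> : (1 - x) * \sum_(c < n) x ^+ c = 1 - x ^+ n.
  by rewrite -[in RHS](expr1n _ n) subrXX; congr (_ * _); apply: eq_bigr => i _; rewrite expr1n mul1r.
by rewrite lerBlDr lerDl exprn_ge0.
Qed.

(** The product builds up a binomial coefficient whose upper index is at most 2 M. *)
Lemma prod_binomial n : \prod_(k < n) (if (k < M)%N then (M + k.+1)%:R / k.+1%:R else 1)
   <= 2 ^+ (2 * M) :> F.
Proof.
have -> : \prod_(k < n) (if (k < M)%N then (M + k.+1)%:R / k.+1%:R else 1) =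
    'C(M + minn n M, minn n M)%:R :> F.
  elim: n => [|n IH]; first by rewrite big_ord0 min0n bin0.
  rewrite big_ord_recr /= IH; case: ltnP => [lt_nM|le_Mn].
    rewrite (minn_idPl lt_nM).
    rewrite mulrA; apply: canLR (mulfK _) _; first by rewrite pnatr_eq0.
    have := mul_bin_diag (M + n.+1) n; rewrite addnS /= => h.
    by rewrite -!natrM mulnC h mulnC.
  by rewrite (minn_idPr (leqW le_Mn)) mulr1.
rewrite -natrX ler_nat.
have bin_le a b : ('C(a, b) <= 2 ^ a)%N.
  elim: a b => [|a IH] [|b]; rewrite ?bin0 ?expn_gt0 //.
  by rewrite binS expnS mul2n -addnn leq_add.
apply: leq_trans (bin_le _ _) _; by rewrite leq_exp2l // mulSn mul1n leq_add2l geq_minr.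
Qed.

End GeneratingFunction.

(** * The upper bound *)

Section Exponential.

Import Order.TTheory GRing.Theory Num.Theory.
Local Open Scope ring_scope.

(** The exponential is abstract, given by four properties; [ln_p_le] instantiates it with the real
    one. *)
Variables (F : realFieldType) (exp : F -> F).
Hypotheses (exp0 : exp 0 = 1) (expD : forall x y, exp x * exp y = exp (x + y)).
Hypotheses (exp_ge1Dx : forall x, 1 + x <= exp x) (exp_mono : forall x y, x <= y -> exp x <= exp y).

Lemma exp_gt0 x : 0 < exp x.
Proof.
have exp_ge0 y : 0 <= exp y.
  by rewrite (_ : y = y / 2 + y / 2) -?expD -?expr2 ?sqr_ge0 //; lra.
rewrite lt_def exp_ge0 andbT; apply/eqP => e0.
by have := expD x (- x); rewrite e0 mul0r subrr exp0 => /eqP; rewrite eq_sym oner_eq0.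
Qed.

Lemma expX x n : exp x ^+ n = exp (x *+ n).
Proof. by elim: n => [|n IH]; rewrite ?expr0 ?mulr0n ?exp0 // exprS IH expD mulrS. Qed.

Lemma exp_sum n (f : nat -> F) : \prod_(k < n) exp (f k) = exp (\sum_(k < n) f k).
Proof. by rewrite (big_morph exp (fun x y => esym (expD x y)) exp0). Qed.

(** Let x = q^j with j = k + 1. For j <= M, x <= M / (M + j) gives 1 / (1 - x) <= (M + j) / j, with
    product at most 2^(2M) <= exp (2M). For j > M, x <= 1/2 gives 1 / (1 - x) <= 1 + 2x <= exp (2x),
    with product at most exp (2M). *)
Lemma young_gf_le (M n : nat) : (0 < M)%N ->
  young_gf n (M%:R / M.+1%:R : F) <= exp (4 * M%:R).
Proof.
move=> M_gt0; set q : F := M%:R / M.+1%:R.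
have q_ge0 : 0 <= q by rewrite divr_ge0.
have q_lt1 : q < 1 by rewrite ltr_pdivrMr ?ltr0n // mul1r ltr_nat.
pose b k : F := if (k < M)%N then (M + k.+1)%:R / k.+1%:R else 1.
have le_f (k : nat) : \sum_(c < n.+1) q ^+ (k.+1 * c) <= b k * exp (2 * q ^+ k.+1).
  set x := q ^+ k.+1; have x0 : 0 <= x by rewrite exprn_ge0.
  have lex : x <= M%:R / (M%:R + k.+1%:R) by apply: q_exp_le.
  have D0 : 0 < M%:R + k.+1%:R :> F by rewrite ltr_wpDl ?ltr0n.
  have x1 : x < 1 by rewrite exprn_ilt1.
  apply: (@le_trans _ _ (1 - x)^-1).
    rewrite (eq_bigr (fun c : 'I_n.+1 => x ^+ c)) => [|c _]; last by rewrite exprM.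
    exact: geometric_le.
  have e1 : 1 <= exp (2 * x) by have := exp_ge1Dx (2 * x); lra.
  have y0 : 0 < 1 - x by rewrite subr_gt0.
  rewrite /b; case: ltnP => [lt_kM|le_Mk].
    apply: (@le_trans _ _ ((M + k.+1)%:R / k.+1%:R)); last first.
      by apply: ler_peMr => //; rewrite divr_ge0.
    have k0 : 0 < k.+1%:R :> F by rewrite ltr0n.
    rewrite -div1r ler_pdivrMr // mulrAC ler_pdivlMr // mul1r natrD.
    by move: lex; rewrite ler_pdivlMr //; lra.
  rewrite mul1r; apply: le_trans (exp_ge1Dx _).
  have xh : x <= 1 / 2.
    apply: le_trans lex _; rewrite ler_pdivrMr // .
    have : M%:R <= k.+1%:R :> F by rewrite ler_nat ltnW.
    by lra.
  by rewrite -div1r ler_pdivrMr //; nra.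
apply: (@le_trans _ _ (\prod_(k < n) (b k * exp (2 * q ^+ k.+1)))).
  by apply: ler_prod => k _; rewrite sumr_ge0 //= => c _; rewrite exprn_ge0.
rewrite big_split (exp_sum _ (fun k => 2 * q ^+ k.+1)) /= -mulr_sumr.
apply: (@le_trans _ _ (exp 1 ^+ (2 * M) * exp (2 * M%:R))).
  apply: ler_pM.
  - by apply: prodr_ge0 => k _; rewrite /b; case: ifP => // _; rewrite divr_ge0.
  - exact/ltW/exp_gt0.
  - apply: le_trans (prod_binomial _ M n) _.
    by apply: lerXn2r; rewrite ?nnegrE ?(ltW (exp_gt0 _)) //; apply: le_trans (exp_ge1Dx _); lra.
  - by apply: exp_mono; rewrite ler_pM2l //; apply: sum_q_exp_le.
by rewrite expX expD; apply: exp_mono; rewrite -[1 *+ _]/(_%:R) natrM; lra.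
Qed.

Lemma card_corner_le d n M : (2 <= d)%N -> (32 * d ^ 4 <= M)%N -> (n < M.+1 ^ d)%N ->
  #|{: box d n * ('I_d * 'I_d)}|.+1%:R <= exp (M%:R) .
Proof.
move=> d2 leM lt_n; rewrite !card_prod card_ffun !card_ord.
have M_gt0 : (0 < M)%N by apply: leq_trans leM; rewrite muln_gt0 expn_gt0 (ltnW d2).
have le1 : ((n ^ d * (d * d)).+1 <= M.+1 ^ (2 * d ^ 2))%N.
  have le_nd : (n ^ d <= M.+1 ^ (d ^ 2))%N.
    by rewrite (expnS d 1) expn1 expnM leq_exp2r ?(ltnW d2) // ltnW.
  have le_dM : ((d * d).+1 <= M.+1 ^ (d ^ 2))%N.
    apply: (@leq_trans (M.+1 ^ 1)); last by rewrite leq_exp2l // expn_gt0 (ltnW d2).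
    by rewrite expn1 ltnS; apply: leq_trans leM; rewrite !expnS expn0; nia.
  have X0 : (0 < M.+1 ^ (d ^ 2))%N by rewrite expn_gt0.
  rewrite mul2n -addnn expnD; nia.
(* The count is at most (M + 1)^(2D), so M + 1 <= exp y with y = M / (2D) suffices. It follows from
   exp y >= (1 + y/2)^2, whose term y^2 / 4 is at least M because 32 D^2 <= M. *)
pose D : F := (d ^ 2)%:R; have D1 : 4 <= D.
  by rewrite (ler_nat _ 4) (@leq_exp2r 2 d 2).
have M32 : 32 * D ^+ 2 <= M%:R by rewrite -natrX -natrM ler_nat -expnM.
pose y := M%:R / (2 * D).
have y_ge : M.+1%:R <= exp y.
  have -> : y = (y / 2) *+ 2 by rewrite -mulr_natr divfK // pnatr_eq0.
  rewrite -expX; apply: (@le_trans _ _ ((1 + y / 2) ^+ 2)).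
    have sq (m e : F) : e != 0 -> (1 + m / (2 * e) / 2) ^+ 2 =
      1 + m / (2 * e) + m * (m / (16 * e ^+ 2)) by move=> ?; field.
    rewrite -natr1 /y sq; last by rewrite gt_eqF //; lra.
    have h1 : 0 <= M%:R / (2 * D) by rewrite divr_ge0 //; lra.
    have h2 : 1 <= M%:R / (16 * D ^+ 2) by rewrite ler_pdivlMr ?mul1r; nra.
    have := ler_wpM2l (ler0n F M) h2; lra.
  by apply: lerXn2r; rewrite ?nnegrE ?(ltW (exp_gt0 _)) ?exp_ge1Dx // addr_ge0 // divr_ge0 // /y divr_ge0 //; lra.
apply: (@le_trans _ _ (M.+1%:R ^+ (2 * d ^ 2))); first by rewrite -natrX ler_nat.
apply: (@le_trans _ _ (exp y ^+ (2 * d ^ 2))).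
  by apply: lerXn2r; rewrite ?nnegrE ?(ltW (exp_gt0 _)).
rewrite expX; apply: exp_mono; rewrite -[leLHS]mulr_natr natrM -/D /y divfK //.
by rewrite gt_eqF //; lra.
Qed.

(** The exponent 603 is 600 + 2 + 1: N = 120 M^(d-2) corners cost M + 4 M each, q^-n costs n / M <=
    2 M^(d-1), and the factor 2 from averaging is at most exp 1. *)
Lemma p_le_exp d n M : (2 <= d)%N -> (32 * d ^ 4 <= M)%N -> (M ^ d <= n)%N ->
  (n < M.+1 ^ d)%N -> (n <= 2 * M ^ d)%N ->
  (p d n)%:R <= exp (603 * M%:R ^+ d.-1).
Proof.
move=> d2 leM le_Mn lt_nM le_n2M.
have M_gt0 : (0 < M)%N by apply: leq_trans leM; rewrite muln_gt0 expn_gt0 (ltnW d2).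
have le_dM : (d <= M)%N.
  by apply: leq_trans leM; rewrite -[X in (X <= _)%N]mul1n leq_mul // -[X in (X <= _)%N]expn1 leq_exp2l.
have M6 : (6 <= M)%N.
  by apply: leq_trans leM; rewrite -[6%N]muln1 leq_mul // expn_gt0 (ltnW d2).
pose q : F := M%:R / M.+1%:R; pose N := (120 * M ^ (d - 2))%N.
have q_gt0 : 0 < q by rewrite divr_gt0 ?ltr0n.
have q_le1 : q <= 1 by rewrite ler_pdivrMr ?ltr0n // mul1r ler_nat.
pose X : F := #|{: box d n * ('I_d * 'I_d)}|.+1%:R ^+ N * young_gf n q ^+ N / q ^+ n.
have le_pX : (p d n)%:R <= 2 * X.
  apply: (@p_le_few_corners d n d2 F N X) => [s|S _ cardS]; last first.
    exact: (@sum_corners_le d n M).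
  rewrite ler_pdivlMr ?exprn_gt0 //.
  by apply: card_few_corners => //; [apply: rank_of_inj | apply: ltW].
apply: le_trans le_pX _.
have young0 : 0 <= young_gf n q by apply: le_trans (young_gf_ge1 n (ltW q_gt0)).
have le1 : #|{: box d n * ('I_d * 'I_d)}|.+1%:R ^+ N * young_gf n q ^+ N <= exp (5 * M%:R) ^+ N.
  rewrite -exprMn; apply: lerXn2r; rewrite ?nnegrE ?(ltW (exp_gt0 _)) ?mulr_ge0 //.
  rewrite (_ : 5 * M%:R = M%:R + 4 * M%:R); last by ring.
  rewrite -expD; apply: ler_pM => //; first exact: card_corner_le.
  exact: young_gf_le.
have le2 : (q ^+ n)^-1 <= exp (M%:R ^-1) ^+ n.
  rewrite -exprVn; apply: lerXn2r; rewrite ?nnegrE ?(ltW (exp_gt0 _)) ?invr_ge0 ?(ltW q_gt0) //.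
  apply: le_trans (exp_ge1Dx _); rewrite /q invf_div -natr1 mulrDl divff ?mul1r //.
  by rewrite pnatr_eq0 -lt0n.
have le3 : 2 <= exp 1 by apply: le_trans (exp_ge1Dx _); lra.
apply: (@le_trans _ _ (exp 1 * (exp (5 * M%:R) ^+ N * exp (M%:R^-1) ^+ n))).
  apply: ler_pM => //.
    by rewrite /X !(mulr_ge0, exprn_ge0) // invr_ge0 exprn_ge0 // ltW.
  by rewrite /X; apply: ler_pM => //; rewrite ?invr_ge0 ?mulr_ge0 ?exprn_ge0 // ltW.
rewrite !expX !expD; apply: exp_mono.
have M0 : 0 < M%:R :> F by rewrite ltr0n.
have ed : M%:R ^+ d.-1 = M%:R * M%:R ^+ (d - 2) :> F.
  by rewrite -exprS; congr (_ ^+ _); lia.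
have ge1 : 1 <= M%:R ^+ d.-1 :> F by rewrite exprn_ege1 // (ler_nat _ 1).
have le_n : M%:R^-1 *+ n <= 2 * M%:R ^+ d.-1 :> F.
  rewrite -[leLHS]mulr_natl ler_pdivrMr // -mulrA -exprSr prednK ?(ltnW d2) //.
  by rewrite -natrX -natrM ler_nat.
have -> : (5 * M%:R) *+ N = 600 * M%:R ^+ d.-1 :> F.
  by rewrite -[LHS]mulr_natr /N natrM natrX ed; ring.
lra.
Qed.

End Exponential.

(** * The lower bound *)

Section Arm.

Variables (d n : nat).
Notation pt := (box d.+1 n.+1).

Definition axis_pt (t : 'I_n.+1) : pt := [ffun k => if k == ord0 then t else ord0].

Lemma axis_pt_inj : injective axis_pt.
Proof. by move=> t t' /ffunP/(_ ord0); rewrite !ffunE. Qed.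

Lemma axis_pt_below (y : pt) t : (forall k, y k <= axis_pt t k) -> y = axis_pt (y ord0).
Proof.
move=> le_y; apply/ffunP => k; rewrite ffunE; case: eqP => [->//|/eqP k0].
by have := le_y k; rewrite ffunE (negbTE k0) leqn0 => /eqP e; apply/val_inj.
Qed.

(* Lengthening the arm of each set along the first axis normalises the cardinal without losing information. *)
Lemma card_arm_family (m : nat) (Fam : {set {set pt}}) : m <= n.+1 ->
  (forall T, T \in Fam -> [/\ lower_set T, #|T| <= n.+1
     & forall t, (axis_pt t \in T) = (t < m)]) ->
  #|Fam| <= p d.+1 n.+1.
Proof.
move=> le_mn H.
(* The arm has n + 1 - #|T| new points from m on; deleting all axis points from m on gives T
   back. *)
pose ext (T : {set pt}) := T :|: axis_pt @: [set t : 'I_n.+1 | m <= t < m + (n.+1 - #|T|)].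
have ext_inj : {in Fam &, injective ext}.
  have rec T : T \in Fam -> T = ext T :\: axis_pt @: [set t : 'I_n.+1 | m <= t].
    move=> TF; have [_ _ ax] := H T TF; apply/setP => x; rewrite !inE.
    have [/imsetP[t + ->]|nx] := boolP (x \in axis_pt @: [set t : 'I_n.+1 | m <= t]).
      by rewrite inE ax /= leqNgt => /negbTE.
    rewrite /=; case: (x \in T) => //=; apply/esym/negbTE; apply: contraNN nx.
    by case/imsetP => t; rewrite inE => /andP[le_t _] ->; apply: imset_f; rewrite inE.
  by move=> T T' TF TF' e; rewrite (rec T TF) (rec T' TF') e.
rewrite -(card_in_imset ext_inj); apply/subset_leq_card/subsetP => _ /imsetP[T TF ->].
have [lT cT ax] := H T TF; rewrite inE; apply/andP; split.
  apply/lower_setP => x y; rewrite !inE => /orP[xT le_yx|/imsetP[t + ->] le_y].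
    by move/lower_setP: lT => /(_ x y xT le_yx) ->.
  rewrite inE => /andP[_ lt_t]; rewrite (axis_pt_below le_y) ax.
  case: ltnP => //= le_m; apply: imset_f; rewrite inE le_m /=.
  by apply: leq_ltn_trans lt_t; have := le_y ord0; rewrite ffunE.
(* This keeps the end of the arm, m + (n + 1 - #|T|), inside the box. *)
have le_mT : m <= #|T|.
  have e : #|[set t : 'I_n.+1 | 0 <= t < m]| = m - 0 by apply: card_ord_interval.
  rewrite subn0 in e; rewrite -e -(card_imset _ axis_pt_inj).
  by apply/subset_leq_card/subsetP => _ /imsetP[t + ->]; rewrite inE ax.
rewrite /ext cardsU (_ : T :&: _ = set0); last first.
  apply/setP => x; rewrite !inE; apply/negP => /andP[xT /imsetP[t + ex]].
  by move: xT; rewrite ex ax inE => lt_t /andP[]; rewrite leqNgt lt_t.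
rewrite cards0 subn0 (card_imset _ axis_pt_inj) card_ord_interval; last by lia.
by rewrite addKn subnKC.
Qed.

Lemma card_simplex_le m : m <= n ->
  #|[set x : pt | \sum_k (x k : nat) <= m]| <= 'C(m + d.+1, d.+1).
Proof.
move=> le_mn; rewrite addnS -addSn -sum_bin_diag cardsE -sum1_card.
rewrite (partition_big (fun x : pt => inord (\sum_k (x k : nat)) : 'I_m.+1) xpredT) //=.
apply: leq_sum => s _; rewrite addnC -(@card_layer d n.+1 s) ?(leq_ltn_trans _ (ltn_ord s)) //.
  rewrite sum1_card; apply/subset_leq_card/subsetP => x; rewrite unfold_in inE => /andP[le_x /eqP <-].
  by rewrite inordK.
by apply: leq_trans (ltn_ord s) _.
Qed.

(** The points of sum below m are joined with any part of layer m other than its point on the first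
    axis. Leaving that point out makes the arm start exactly at m and costs the 1 in the exponent;
    the hypothesis bounds the full simplex. *)
Lemma p_ge_simplex m : 'C(m + d.+1, d.+1) <= n.+1 -> 2 ^ 'C(d + m, d).-1 <= p d.+1 n.+1.
Proof.
move=> le_n.
have lt_mn : m < n.+1 by apply: leq_trans le_n; apply: lt_bin.
pose m' := Ordinal lt_mn; pose sz (x : pt) := \sum_k (x k : nat).
pose L := [set x | sz x == m] :\ axis_pt m'.
have sz_axis t : sz (axis_pt t) = t.
  by rewrite /sz (bigD1 ord0) //= ffunE eqxx big1 ?addn0 // => k /negbTE k0; rewrite ffunE k0.
have cardL : #|L| = 'C(d + m, d).-1.
  by rewrite -(card_layer d lt_mn) [in RHS](cardsD1 (axis_pt m')) inE -/(sz _) sz_axis eqxx.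
pose T (A : {set pt}) := [set x | sz x < m] :|: A.
have T_inj : {in powerset L &, injective T}.
  have rec A : A \in powerset L -> A = T A :\: [set x | sz x < m].
    rewrite inE => /subsetP sA; apply/setP => x; rewrite !inE.
    have [lt_x|ge_x] /= := ltnP; last by [].
    apply/negbTE; apply: contraTN lt_x => /sA; rewrite !inE => /andP[_ /eqP->].
    by rewrite ltnn.
  by move=> A B AP BP e; rewrite (rec A AP) (rec B BP) e.
rewrite -cardL -card_powerset -(card_in_imset T_inj).
apply: (@card_arm_family m) => [|_ /imsetP[A + ->]]; first exact: ltnW.
rewrite inE => /subsetP sA; split.
- apply/lower_setP => x y; rewrite !inE => xT le_yx.
  have le_sz : sz y <= sz x by apply: leq_sum.
  case/orP: xT => [lt_x|xA]; first by rewrite (leq_ltn_trans le_sz lt_x).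
  have := sA x xA; rewrite !inE => /andP[_ /eqP sx].
  move: le_sz; rewrite leq_eqVlt sx => /orP[/eqP e|->//].
  suff -> : y = x by rewrite xA orbT.
  apply/ffunP => k; apply/val_inj/eqP; rewrite eqn_leq le_yx leqNgt.
  apply/negP => lt_k; have : sz y < sz x.
    by rewrite /sz (bigD1 k) //= [X in _ < X](bigD1 k) //= -addSn leq_add // leq_sum.
  by rewrite e sx ltnn.
- apply: leq_trans le_n; apply: leq_trans (card_simplex_le (lt_mn : m <= n)).
  apply/subset_leq_card/subsetP => x; rewrite !inE => /orP[/ltnW//|xA].
  by have := sA x xA; rewrite !inE => /andP[_ /eqP sx]; rewrite -/(sz x) sx.
- move=> t; rewrite !inE sz_axis; case: ltnP => //= le_mt.
  apply/negP => /sA; rewrite !inE sz_axis => /andP[ne /eqP e].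
  by case/eqP: ne; congr axis_pt; apply/val_inj.
Qed.

End Arm.

(** A weakly increasing tuple is read backwards as column heights, plus 1. Thus all a columns are
    nonempty, the first axis is met exactly a times, and the diagram fits in a by a + 1. *)
Lemma p_ge_paths a n : a * a.+1 <= n.+1 -> 'C(a + a, a) <= p 2 n.+1.
Proof.
move=> le_n; rewrite -card_sorted_tuples.
have lt_an : a < n.+1.
  by move: le_n; case: (a) => // b; rewrite mulSn; apply: leq_trans (leq_addr _ _).
pose ht (t : a.-tuple 'I_a.+1) i : nat := nth 0 (map val t) i.
pose T (t : a.-tuple 'I_a.+1) : {set box 2 n.+1} :=
  [set x : box 2 n.+1 | (x ord0 < a) && (x ord_max <= ht t (a.-1 - x ord0))].
set Fam := [set t | _].
have ht_le t i : ht t i <= a.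
  rewrite /ht; have [lt_i|ge_i] := ltnP i (size t); last by rewrite nth_default // size_map.
  by rewrite (nth_map ord0) // -ltnS ltn_ord.
have ht_mono t i j : t \in Fam -> i <= j -> j < a -> ht t i <= ht t j.
  rewrite inE => st le_ij lt_j; apply: (sorted_leq_nth leq_trans leqnn) => //.
    by rewrite inE size_map size_tuple (leq_ltn_trans le_ij).
  by rewrite inE size_map size_tuple.
have T_inj : injective T.
  have le t t' i : T t = T t' -> i < a -> ht t i <= ht t' i.
    move=> e lt_i.
    have lt1 : a.-1 - i < n.+1 by nia.
    have lt2 : ht t i < n.+1 by have := ht_le t i; nia.
    pose x : box 2 n.+1 := [ffun k => if k == ord0 then Ordinal lt1 else Ordinal lt2].
    have ei : a.-1 - (a.-1 - i) = i by lia.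
    have : x \in T t by rewrite inE !ffunE /= ei leqnn andbT; lia.
    by rewrite e inE !ffunE /= ei => /andP[].
  move=> t t' e; apply/val_inj/(inj_map val_inj)/(@eq_from_nth _ 0).
    by rewrite !size_map !size_tuple.
  move=> i; rewrite size_map size_tuple => lt_i; apply/eqP; rewrite eqn_leq.
  by rewrite (le t t') // (le t' t).
rewrite -(card_imset _ T_inj).
have a_le : a <= n.+1 by apply: ltnW.
apply: (@card_arm_family 1 n a) => [//|_ /imsetP[t tF ->]]; split.
- apply/lower_setP => x y; rewrite !inE => /andP[lt_x le_x] le_yx.
  rewrite (leq_ltn_trans (le_yx _) lt_x); apply: leq_trans (le_yx _) _.
  apply: leq_trans le_x _; apply: ht_mono => //; last by have := le_yx ord0; lia.
  by rewrite leq_sub2l.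
- apply: leq_trans le_n.
  pose f (x : box 2 n.+1) := (x ord0, x ord_max).
  have f_inj : injective f.
    move=> x y [e0 e1]; apply/ffunP => k; case: (unliftP ord0 k) => [k'|] -> //.
    by rewrite (ord1 k') (_ : lift ord0 ord0 = ord_max) //; apply/val_inj.
  rewrite -(card_imset _ f_inj).
  apply: (@leq_trans #|setX [set u : 'I_n.+1 | 0 <= u < a] [set u : 'I_n.+1 | 0 <= u < a.+1]|).
    apply/subset_leq_card/subsetP => _ /imsetP[x + ->]; rewrite !inE /= => /andP[-> le_x].
    by rewrite ltnS (leq_trans le_x).
  by rewrite cardsX !card_ord_interval // !subn0.
- by move=> u; rewrite inE !ffunE /= leq0n andbT.
Qed.

(** * Numerical estimates for the lower bound *)

Lemma nat_root (f : nat -> nat) n : f 0 <= n -> (forall m, m < f m.+1) ->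
  exists2 m, f m <= n & n < f m.+1.
Proof.
move=> f0 f_gt.
have ex : exists m, f m <= n by exists 0.
have ub m : f m <= n -> m <= n by case: m => // m le; apply: leq_trans (f_gt m) le.
have [m le_m max_m] := ex_maxnP ex ub; exists m => //.
by rewrite ltnNge; apply/negP => /max_m; rewrite ltnn.
Qed.

(** For d <= M / 2, (1 + 1/M)^d <= 1 + 1/2 + 1/4. *)
Lemma exp_succ_le_double M d : 2 * d <= M -> M.+1 ^ d <= 2 * M ^ d.
Proof.
move=> le_dM; case: M => [|M] in le_dM *; first by case: d le_dM.
have le_d : d <= M.+1 by lia.
have := succ_exp_le le_d.
have h : M.+1 ^ 2 + d * M.+1 + d ^ 2 <= 2 * M.+1 ^ 2 by rewrite !expnS !expn0; nia.
have pos : 0 < M.+1 ^ 2 by rewrite expn_gt0.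
move=> le1; rewrite -(leq_pmul2r pos); apply: leq_trans le1 _.
by rewrite (mulnC 2) -mulnA leq_mul2l h orbT.
Qed.

Lemma exp_le_ffact m k : (m.+1 - k) ^ k <= m ^_ k.
Proof.
elim: k m => // k IH [|m]; first by rewrite subSS sub0n exp0n.
by rewrite ffactnS expnS subSS leq_mul ?leq_subr //=.
Qed.

(** Bernoulli's inequality (1 - d/x)^k >= 1 - k d/x, cleared of denominators. *)
Lemma bernoulli_sub x d k : k * d <= x -> x ^ k * (x - k * d) <= (x - d) ^ k * x.
Proof.
elim: k => [|k IH] le_kd; first by rewrite !expn0 !mul1n mul0n subn0.
have {}IH := IH (leq_trans (leq_mul (leqnSn k) (leqnn d)) le_kd).
rewrite !expnS.
apply: (@leq_trans ((x - d) * (x ^ k * (x - k * d)))); last by rewrite -mulnA leq_mul2l IH orbT.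
rewrite [leqRHS]mulnCA -mulnA mulnCA leq_mul2l; apply/orP; right.
nia.
Qed.

(** The ratio 312 / 200 = (8/5) (39/40) = 1.56 exceeds 3/2 >= 1 / ln 2. The factor 8/5 comes from
    d^d / d! >= (8/5)^d, and 39/40 from replacing X by X - d, where X >= 40 d^2. *)
Lemma layer_ge d n m : 3 <= d -> n < 'C(m.+1 + d, d) -> 40 * d ^ 2 <= m.+1 + d ->
  312 ^ d * n ^ d.-1 <= (200 * 'C(d.-1 + m, d.-1)) ^ d.
Proof.
case: d => // e d3 lt_n leX; rewrite succnK in lt_n leX *.
set d := e.+1 in d3 lt_n leX *; set X := m.+1 + d in lt_n leX; set L := 'C(_, _); set A := X - d.
have X_gt0 : 0 < X by rewrite /X addSn.
have n_le : n * d`! <= X ^ d.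
  by apply: leq_trans (ffact_le_exp X d); rewrite -bin_ffact leq_mul2r ltnW ?orbT.
have L_ge : A ^ e <= L * e`!.
  rewrite bin_ffact; apply: leq_trans (exp_le_ffact _ _).
  by apply: leq_exp2r_weak; rewrite /A /X /d; lia.
have X_le : 39 * X ^ e <= 40 * A ^ e.
  have le_dX : e * d <= X by apply: leq_trans leX; rewrite !expnS expn0 /d; nia.
  have b := bernoulli_sub le_dX; rewrite -/A in b.
  have h : 39 * X <= 40 * (X - e * d) by move: leX; rewrite !expnS expn0 /d; nia.
  have tr x a t y : x * t <= a * y -> x * (39 * y) <= x * (40 * t) ->
    39 * x * y <= 40 * a * y by lia.
  by rewrite -(leq_pmul2r X_gt0); apply: tr b (leq_mul (leqnn _) h).
have f_gt0 : 0 < e`! by apply: fact_gt0.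
(* Eliminating (d-1)! from both bounds gives L^d / n^(d-1) >= (A / X)^(d (d-1)) d^d / d!. *)
have main : (A ^ e) ^ d * (n ^ e * d ^ d) <= L ^ d * d`! * (X ^ e) ^ d.
  have h1 : (A ^ e) ^ d <= L ^ d * (e`! * e`! ^ e).
    by rewrite -expnS -/d -expnMn; apply: leq_exp2r_weak.
  have h2 : n ^ e * (d ^ e * e`! ^ e) <= (X ^ e) ^ d.
    by rewrite -!expnMn -factS -(expnM X) (mulnC e) expnM; apply: leq_exp2r_weak.
  have fe_gt0 : 0 < e`! ^ e by rewrite expn_gt0 f_gt0.
  have cancel (D a n' d' g x l f : nat) : 0 < g -> a * (n' * (d' * g)) <= l * (f * g) * x ->
      a * (n' * (D * d')) <= l * (D * f) * x.
    move=> g0 h; rewrite -(leq_pmul2r g0); apply: (@leq_trans (D * (a * (n' * (d' * g))))); first by lia.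
    by apply: (@leq_trans (D * (l * (f * g) * x))); [rewrite leq_mul2l h orbT | lia].
  by rewrite factS -/d (expnS d e); apply: cancel fe_gt0 (leq_mul h1 h2).
have X_le' : 39 ^ d * (X ^ e) ^ d <= 40 ^ d * (A ^ e) ^ d.
  by rewrite -!expnMn; apply: leq_exp2r_weak.
have fle := fact_le_exp_self d3.
have Z_gt0 : 0 < d ^ d * (X ^ e) ^ d by rewrite muln_gt0 !expn_gt0 X_gt0.
have combine (c8 c39 c40 c5 a n' dd x l f : nat) : a * (n' * dd) <= l * f * x -> c39 * x <= c40 * a ->
    c8 * f <= c5 * dd -> c8 * c39 * n' * (dd * x) <= c5 * c40 * l * (dd * x).
  move=> h1 h2 h3; apply: (@leq_trans (c8 * n' * dd * (c39 * x))); first by lia.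
  apply: (@leq_trans (c8 * n' * dd * (c40 * a))); first by rewrite leq_mul2l h2 orbT.
  apply: (@leq_trans (c8 * c40 * (a * (n' * dd)))); first by lia.
  apply: (@leq_trans (c8 * c40 * (l * f * x))); first by rewrite leq_mul2l h1 orbT.
  apply: (@leq_trans (c40 * l * x * (c8 * f))); first by lia.
  by apply: (@leq_trans (c40 * l * x * (c5 * dd))); [rewrite leq_mul2l h3 orbT | lia].
have e312 : 312 = 8 * 39 by [].
have e200 : 200 = 5 * 40 by [].
by rewrite -(leq_pmul2r Z_gt0) e312 e200 !expnMn; apply: combine main X_le' fle.
Qed.

(** The ratio of consecutive central binomials, 2 (2a + 1) / (a + 1), is at least 7/2 from a = 3
    on. *)
Lemma central_binomial_ge a : 3 <= a -> 7 ^ (a - 3) <= 2 ^ (a - 3) * 'C(a + a, a).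
Proof.
elim: a => // a IH; rewrite ltnS leq_eqVlt => /orP[/eqP <- //|a3].
have {}IH := IH a3; rewrite subSn // !expnS addSn addnS.
have h : a.+1 * 'C((a + a).+2, a.+1) = 2 * (a + a).+1 * 'C(a + a, a).
  have h1 := mul_bin_diag (a + a).+2 a; have h2 := mul_bin_diag (a + a).+1 a.
  have h3 : 'C((a + a).+1, a) = 'C((a + a).+1, a.+1).
    by rewrite -bin_sub; [congr ('C(_, _)); lia | lia].
  rewrite /= in h1 h2; rewrite -h1 h3.
  have -> : (a + a).+2 * 'C((a + a).+1, a.+1) = 2 * (a.+1 * 'C((a + a).+1, a.+1)) by lia.
  by rewrite -h2; lia.
rewrite -(leq_pmul2l (ltn0Sn a)).
apply: (@leq_trans (a.+1 * 7 * (2 ^ (a - 3) * 'C(a + a, a)))); first by rewrite -mulnA leq_mul2l /= leq_mul2l.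
rewrite (_ : a.+1 * (2 * 2 ^ (a - 3) * 'C((a + a).+2, a.+1)) = 2 ^ (a - 3) * (2 * (a.+1 * 'C((a + a).+2, a.+1)))); last by lia.
rewrite h.
rewrite (_ : a.+1 * 7 * (2 ^ (a - 3) * 'C(a + a, a)) = 2 ^ (a - 3) * (7 * a.+1 * 'C(a + a, a))); last by lia.
rewrite leq_mul2l; apply/orP; right; rewrite !mulnA leq_mul2r; apply/orP; right; lia.
Qed.

(** * Logarithms *)

(** The d-th root of the threshold is (30 d)^(2d) >= (30 d)^4. *)
Lemma threshold_root d n X : 2 <= d -> (30 * d) ^ (2 * d ^ 2) <= n -> n < X ^ d ->
  900 * d ^ 4 < X.
Proof.
move=> d2 le_n lt_n.
have d_gt0 : 0 < d by apply: ltnW.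
have lt_X : (30 * d) ^ (2 * d) < X.
  have := leq_ltn_trans le_n lt_n.
  by rewrite (expnS d 1) expn1 mulnA expnM ltn_exp2r.
apply: leq_ltn_trans lt_X; apply: (@leq_trans ((30 * d) ^ 4)).
  by rewrite expnMn leq_mul2r (expnD 30 2 2) leq_pmulr ?orbT.
by rewrite leq_exp2l; lia.
Qed.

Local Open Scope R_scope.

Lemma ln_le x y : 0 < x -> x <= y -> ln x <= ln y.
Proof.
by move=> x0 [lt|->]; [apply/Rlt_le/ln_increasing | apply: Rle_refl].
Qed.

Lemma INR_expn a b : INR (a ^ b)%N = INR a ^ b.
Proof. by elim: b => [|b IH]; rewrite ?expn0 // expnS -multE mult_INR IH. Qed.

Lemma INR_leq a b : (a <= b)%N -> INR a <= INR b.
Proof. by move/leP; apply: le_INR. Qed.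

Lemma Rmult_one_minus_inv x y : x <> 0 -> (1 - 1 / x) * (x * y) = (x - 1) * y.
Proof.
move=> x0; have -> : (1 - 1 / x) * (x * y) = x * y - / x * x * y by rewrite /Rdiv; Lra.lra.
by rewrite Rinv_l //; Lra.lra.
Qed.

Lemma exp_pred_le_Rpower d n M : (0 < d)%N -> (0 < M)%N -> (M ^ d <= n)%N ->
  INR M ^ d.-1 <= Rpower (INR n) (1 - 1 / INR d).
Proof.
move=> d0 M0 le_n.
have Mp : 0 < INR M by apply/lt_0_INR/ltP.
have dp : 0 < INR d by apply/lt_0_INR/ltP.
rewrite -[X in X <= _](exp_ln _ (pow_lt _ d.-1 Mp)) ln_pow // /Rpower.
have h : INR d * ln (INR M) <= ln (INR n).
  rewrite -ln_pow // -INR_expn; apply: ln_le (INR_leq le_n).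
  by apply/lt_0_INR/ltP; rewrite expn_gt0 M0.
have ed : INR d.-1 = INR d - 1 by rewrite -[X in INR X - 1](prednK d0) S_INR; Lra.lra.
have e : INR d.-1 * ln (INR M) = (1 - 1 / INR d) * (INR d * ln (INR M)).
  by rewrite ed Rmult_one_minus_inv //; Lra.lra.
have le1 : 1 <= INR d by rewrite -[1]/(INR 1); apply: INR_leq.
have c0 : 0 <= 1 - 1 / INR d.
  have : 1 / INR d <= 1 by apply: (Rmult_le_reg_r (INR d)) => //; rewrite /Rdiv Rmult_assoc Rinv_l; Lra.lra.
  by Lra.lra.
have : INR d.-1 * ln (INR M) <= (1 - 1 / INR d) * ln (INR n).
  by rewrite e; apply: Rmult_le_compat_l.
by case=> [lt|->]; [apply/Rlt_le/exp_increasing | apply: Rle_refl].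
Qed.

Lemma ln_p_le d n M : (2 <= d)%N -> (32 * d ^ 4 <= M)%N -> (M ^ d <= n)%N ->
  (n < M.+1 ^ d)%N -> (n <= 2 * M ^ d)%N -> (0 < p d n)%N ->
  ln (INR (p d n)) <= 603 * INR M ^ d.-1.
Proof.
move=> d2 leM le_n lt_n le_2n p0.
rewrite -[X in _ <= X]ln_exp; apply: ln_le; first by apply/lt_0_INR/ltP.
have expge x : (1 + x <= exp x)%R by apply/RleP/exp_ineq1_le.
have expmono (x y : R) : (x <= y -> exp x <= exp y)%R.
  move/RleP=> [lt|->]; last exact/RleP/Rle_refl.
  by apply/RleP/Rlt_le/exp_increasing.
have := @p_le_exp R exp expR0 expRD expge expmono d n M d2 leM le_n lt_n le_2n.
rewrite -!INRE -RpowE => /RleP.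
rewrite (_ : INR 603 = 603) //; rewrite INR_IZR_INZ //.
Qed.

(** From exp (-x) >= 1 - x at x = 1/15, exp (2/3) <= (15/14)^10 <= 2. *)
Lemma ln2_ge : 2 / 3 <= ln 2.
Proof.
rewrite -[X in X <= _]ln_exp; apply: ln_le; first exact: exp_pos.
have h : exp (1 / 15) <= 15 / 14.
  have := exp_ineq1_le (- (1 / 15)); rewrite exp_Ropp => h.
  have e0 := exp_pos (1 / 15).
  apply: (Rmult_le_reg_r (/ exp (1 / 15))); first exact: Rinv_0_lt_compat.
  by rewrite Rinv_r; Lra.lra.
have -> : exp (2 / 3) = exp (1 / 15) ^ 10.
  by rewrite -Rpower_pow ?/Rpower ?ln_exp; [congr exp; rewrite /=; Lra.lra | exact: exp_pos].
apply: (Rle_trans _ ((15 / 14) ^ 10)); last by Lra.lra.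
by apply: pow_incr; split => //; apply/Rlt_le/exp_pos.
Qed.

(** exp (8/7) = e exp (1/7) <= 3 * 7/6 = 7/2. *)
Lemma ln7_2_ge : ln 2 + 8 / 7 <= ln 7.
Proof.
have h : exp (1 / 7) <= 7 / 6.
  have := exp_ineq1_le (- (1 / 7)); rewrite exp_Ropp => h.
  have e0 := exp_pos (1 / 7).
  apply: (Rmult_le_reg_r (/ exp (1 / 7))); first exact: Rinv_0_lt_compat.
  by rewrite Rinv_r; Lra.lra.
rewrite -(ln_exp (8 / 7)) -ln_mult; [|Lra.lra|exact: exp_pos].
apply: ln_le; first by have := exp_pos (8 / 7); Lra.lra.
have -> : 8 / 7 = 1 + 1 / 7 by Lra.lra.
rewrite exp_plus; have := exp_le_3; have := exp_pos 1; have := exp_pos (1 / 7); Lra.nra.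
Qed.

Lemma ln_p_ge_plane n : (3600 <= n)%N -> Rpower (INR n) (1 - 1 / INR 2) < ln (INR (p 2 n)).
Proof.
move=> n_ge.
have [|m|a le_a lt_a] := @nat_root (fun m => m * m.+1)%N n; [by []|by nia|].
have a_ge : (58 <= a)%N by rewrite leqNgt; apply/negP => lt; nia.
case: n n_ge le_a lt_a => // n n_ge le_a lt_a.
have p_ge := p_ge_paths le_a.
have c_ge := central_binomial_ge (leq_trans (isT : 3 <= 58)%N a_ge).
have {c_ge} : INR (7 ^ (a - 3)) <= INR (2 ^ (a - 3) * p 2 n.+1).
  by apply/INR_leq/(leq_trans c_ge); rewrite leq_mul2l p_ge orbT.
have p_gt0 : 0 < INR (p 2 n.+1).
  by apply/lt_0_INR/ltP; apply: leq_trans p_ge; rewrite bin_gt0 leq_addr.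
rewrite -multE mult_INR !INR_expn => /(ln_le _).
have [e7 e2] : INR 7 = 7 /\ INR 2 = 2 by rewrite /=; split; Lra.lra.
have pow7 : 0 < 7 ^ (a - 3) by apply: pow_lt; Lra.lra.
rewrite e7 e2 => /(_ pow7).
rewrite ln_mult //; last by apply: pow_lt; Lra.lra.
rewrite !ln_pow; [|Lra.lra|Lra.lra] => le1.
have aE : INR (a - 3) = INR a - 3.
  by rewrite -minusE minus_INR /=; [Lra.lra | apply/leP/(leq_trans _ a_ge)].
have a58 : 58 <= INR a by rewrite -[58]/(IZR (Z.of_nat 58)) -INR_IZR_INZ; apply: INR_leq.
have le2 := ln7_2_ge.
(* This exceeds a + 2, an upper bound for the square root, as soon as a > 38. *)
have le3 : (INR a - 3) * (8 / 7) <= ln (INR (p 2 n.+1)) by rewrite aE in le1; Lra.nra.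
have lt_Y : Rpower (INR n.+1) (1 - 1 / 2) < INR a + 2.
  have ap : 0 < INR a + 2 by Lra.lra.
  rewrite -[X in _ < X]exp_ln //; apply: exp_increasing.
  have : ln (INR n.+1) < 2 * ln (INR a + 2).
    rewrite -[2 in X in _ < X]/(INR 2) -ln_pow //; apply: ln_increasing; first by apply/lt_0_INR/ltP.
    have : INR n.+1 < INR (a.+1 * a.+2) by apply/lt_INR/ltP.
    by rewrite -multE mult_INR !S_INR /=; Lra.nra.
  by Lra.lra.
by Lra.lra.
Qed.

Lemma ln_p_ge_solid d n : (3 <= d)%N -> (900 * d ^ 4 <= n)%N ->
  (forall X, n < X ^ d -> 900 * d ^ 4 < X)%N ->
  17 <= Rpower (INR n) (1 - 1 / INR d) ->
  Rpower (INR n) (1 - 1 / INR d) < ln (INR (p d n)).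
Proof.
move=> d3 n_ge n_root; set Y := Rpower _ _ => Y17.
have d_gt0 : (0 < d)%N by apply: leq_trans d3.
have n_gt0 : (0 < n)%N by apply: leq_trans n_ge; rewrite muln_gt0 expn_gt0 d_gt0.
have [||m le_m lt_m] := @nat_root (fun m => 'C(m + d, d)) n.
- by rewrite add0n binn.
- by move=> m; apply: ltn_trans (ltnSn m) (lt_bin _ d_gt0).
have X_ge : (40 * d ^ 2 <= m.+1 + d)%N.
  apply: leq_trans (ltnW (n_root (m.+1 + d)%N _)).
    by rewrite leq_mul // leq_exp2l //; apply: leq_trans d3.
  apply: leq_trans lt_m _; apply: leq_trans (ffact_le_exp _ _).
  by rewrite -bin_ffact leq_pmulr // fact_gt0.
have := layer_ge d3 lt_m X_ge.
have : (2 ^ 'C(d.-1 + m, d.-1).-1 <= p d n)%N.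
  by case: d n n_gt0 {d3 n_ge n_root Y Y17 X_ge lt_m} d_gt0 le_m => // d [//|n] _ _; apply: p_ge_simplex.
have : (0 < 'C(d.-1 + m, d.-1))%N by rewrite bin_gt0 leq_addr.
move: ('C(_, _)) => L L_gt0 p_ge L_ge.
have L0 : 0 < INR L by apply/lt_0_INR/ltP.
have np : 0 < INR n by apply/lt_0_INR/ltP.
have dp : 0 < INR d by apply/lt_0_INR/ltP.
have ln_p : INR L.-1 * ln 2 <= ln (INR (p d n)).
  rewrite -ln_pow; last by Lra.lra.
  rewrite (_ : 2 = INR 2) // -INR_expn; apply: ln_le (INR_leq p_ge).
  by apply/lt_0_INR/ltP; rewrite expn_gt0.
have L1 : INR L.-1 = INR L - 1 by rewrite -[X in INR X - 1](prednK L_gt0) S_INR; Lra.lra.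
have Y_le : 312 * Y <= 200 * INR L.
  have := INR_leq L_ge; rewrite -multE mult_INR !INR_expn mult_INR => /(ln_le _).
  have [e1 e2] : INR 312 = 312 /\ INR 200 = 200 by rewrite !INR_IZR_INZ.
  have pow312 : 0 < 312 ^ d by apply: pow_lt; Lra.lra.
  rewrite e1 e2 => /(_ (Rmult_lt_0_compat _ _ pow312 (pow_lt _ _ np))).
  rewrite ln_mult; [|by apply: pow_lt; Lra.lra|exact: pow_lt].
  rewrite !ln_pow //; [|by Lra.lra|by Lra.lra].
  have ed : INR d.-1 = INR d - 1 by rewrite -[X in INR X - 1](prednK d_gt0) S_INR; Lra.lra.
  rewrite ed => h.
  have h2 : ln 312 + (1 - 1 / INR d) * ln (INR n) <= ln (200 * INR L).
    apply: (Rmult_le_reg_l (INR d)) => //; apply: Rle_trans h.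
    by rewrite Rmult_plus_distr_l (Rmult_comm (1 - _)) -Rmult_assoc (Rmult_comm _ (1 - _)) Rmult_one_minus_inv; Lra.lra.
  rewrite -[X in _ <= X]exp_ln; last by Lra.lra.
  rewrite -[X in X * _ <= _]exp_ln; last by Lra.lra.
  rewrite /Y /Rpower -exp_plus.
  by case: h2 => [lt|->]; [apply/Rlt_le/exp_increasing | apply: Rle_refl].
(* Since 1.56 * 2/3 = 1.04, the surplus 0.04 Y covers the 2/3 lost to the 1 in L - 1 once Y >=
   17. *)
have := ln2_ge; rewrite L1 in ln_p; Lra.nra.
Qed.

Theorem theorem1 (d n : nat) :
  (2 <= d)%N -> ((30 * d) ^ (2 * d ^ 2) <= n)%N ->
  Rlt 1 (Rdiv (ln (INR (p d n))) (Rpower (INR n) (Rminus 1 (Rdiv 1 (INR d))))) /\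
  Rlt (Rdiv (ln (INR (p d n))) (Rpower (INR n) (Rminus 1 (Rdiv 1 (INR d))))) 7200.
Proof.
move=> d2 n_ge; have d_gt0 : (0 < d)%N by apply: ltnW.
have n_root X := threshold_root d2 n_ge (X := X).
(* M is the integer part of the d-th root of n. *)
have [||M le_M lt_M] := @nat_root (fun m => m ^ d)%N n; first by rewrite exp0n.
  by move=> m; rewrite -[X in (X <= _)%N]expn1; apply: leq_pexp2l.
have M_ge : (900 * d ^ 4 <= M)%N by rewrite -ltnS; apply: n_root.
have d4_gt0 : (0 < d ^ 4)%N by rewrite expn_gt0 d_gt0.
have M_gt0 : (0 < M)%N by apply: leq_trans M_ge; rewrite muln_gt0.
have Y_ge := exp_pred_le_Rpower d_gt0 M_gt0 le_M.
have M17 : INR 17 <= INR M.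
  by apply: INR_leq; apply: leq_trans M_ge; apply: leq_trans (leq_pmulr _ d4_gt0).
have M_le_n : (M <= n)%N.
  by apply: leq_trans le_M; rewrite -[X in (X <= _)%N]expn1 leq_pexp2l.
have Y17 : 17 <= Rpower (INR n) (1 - 1 / INR d).
  apply: Rle_trans Y_ge; apply: (Rle_trans _ (INR M ^ 1)).
    by rewrite pow_1; move: M17; rewrite INR_IZR_INZ.
  apply: Rle_pow; last by apply/leP; rewrite -ltnS prednK.
  by rewrite -[1]/(INR 1); apply: INR_leq.
have lower : Rpower (INR n) (1 - 1 / INR d) < ln (INR (p d n)).
  have [d3|d_le2] := ltnP 2 d; first by apply: ln_p_ge_solid => //; apply: leq_trans M_le_n.
  have ed : d = 2%N by apply/eqP; rewrite eqn_leq d_le2.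
  subst d; apply: ln_p_ge_plane; apply: leq_trans M_le_n; apply: leq_trans M_ge.
  by rewrite (_ : 3600 = 900 * 4)%N // leq_mul2l.
(* [ln] is 0 at 0 by convention, so the lower bound itself excludes p = 0. *)
have p_gt0 : (0 < p d n)%N.
  rewrite lt0n; apply/eqP => p0; move: lower Y17; rewrite p0 /=.
  rewrite /ln; case: Rlt_dec => [lt|_] //; first by case: (Rlt_irrefl 0).
  by Lra.lra.
have upper : ln (INR (p d n)) <= 603 * INR M ^ d.-1.
  apply: ln_p_le => //; first by apply: leq_trans M_ge; rewrite leq_mul2r orbT.
  apply: leq_trans (ltnW lt_M) _; apply: exp_succ_le_double.
  apply: leq_trans M_ge; apply: leq_mul => //; rewrite -{1}(expn1 d).
  by rewrite leq_pexp2l.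
set Y := Rpower _ _ in lower Y17 Y_ge *.
have Y0 : 0 < Y by Lra.lra.
have e : ln (INR (p d n)) / Y * Y = ln (INR (p d n)) by rewrite /Rdiv Rmult_assoc Rinv_l ?Rmult_1_r //; Lra.lra.
by split; apply: (Rmult_lt_reg_r Y) => //; rewrite e; Lra.lra.
Qed.
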